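(* Let $I$ be an infinite set and let $\{A_i\}_{i\in I}$ be a family of non-zero unital $^*$-algebras over $\mathbb C$ with identities $e_i$. (a) There is a cocycle twisted action $(\check\Xi,m)$ of the group $\Omega^{\rm ut}_{I;A}$ on $\bigotimes^e_{i\in I}A_i$ such that $\bigotimes^{\rm ut}_{i\in I}A_i$ is $\Omega^{\rm ut}_{I;A}$-graded $^*$-isomorphic to the algebraic crossed product $\big(\bigotimes^e_{i\in I}A_i\big)\rtimes_{\check\Xi,m}\Omega^{\rm ut}_{I;A}$. (b) Suppose that all $A_i$ are commutative. If $\bigotimes^e_{i\in I}A_i$ is a unital $^*$-subalgebra of a commutative $^*$-algebra $B$ such that the group $U_B$ is divisible, then $\bigotimes^{\rm ut}_{i\in I}A_i$ is $\Omega^{\rm ut}_{I;A}$-graded $^*$-isomorphic to a unital $^*$-subalgebra of $B\otimes\mathbb C[\Omega^{\rm ut}_{I;A}]$. If $U_{\bigotimes^e_{i\in I}A_i}$ is itself divisible, then $\bigotimes^{\rm ut}_{i\in I}A_i\cong\big(\bigotimes^e_{i\in I}A_i\big)\otimes\mathbb C[\Omega^{\rm ut}_{I;A}]$ as $\Omega^{\rm ut}_{I;A}$-graded $^*$-algebras.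
   Context: Infinite tensor products: for non-zero vector spaces $X_i$ ($i\in I$), $(\bigotimes_{i\in I}X_i,\Theta_X)$ is the vector space with a multilinear (linear in each variable separately) map $\Theta_X:\prod_{i\in I}X_i\to\bigotimes_{i\in I}X_i$ through which every multilinear map on $\prod_{i\in I}X_i$ factors via a unique linear map (it exists and is unique up to isomorphism); $\otimes_{i\in I}x_i=\Theta_X(x)$. For $x,y\in\prod_{i\in I}(X_i\setminus\{0\})$, $x\sim y$ means $x_i=y_i$ for all but finitely many $i$. For $u\in\prod_{i\in I}(X_i\setminus\{0\})$ and $\omega=[u]_\sim$, $\bigotimes^\omega_{i\in I}X_i=\bigotimes^u_{i\in I}X_i=\mathrm{span}\{\otimes_{i\in I}x_i: x\in\prod_{i\in I}X_i,\ x_i=u_i\text{ for all but finitely many }i\}$; one has $\bigotimes_{i\in I}X_i=\bigoplus_\omega\bigotimes^\omega_{i\in I}X_i$. $\bigotimes_{i\in I}A_i$ is a $^*$-algebra with $(\otimes a_i)(\otimes b_i)=\otimes a_ib_i$ and $(\otimes a_i)^*=\otimes a_i^*$. For a unital $^*$-algebra $A$, $U_A=\{a\in A:a^*a=aa^*=e_A\}$. $\Omega^{\rm ut}_{I;A}=\prod_{i\in I}U_{A_i}/\sim$, a group under coordinatewise multiplication. With $e=[e_i]_{i\in I}$, $\bigotimes^e_{i\in I}A_i$ is a unital $^*$-subalgebra of $\bigotimes_{i\in I}A_i$, and $\bigotimes^{\rm ut}_{i\in I}A_i=\bigoplus_{\omega\in\Omega^{\rm ut}_{I;A}}\bigotimes^\omega_{i\in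 I}A_i$ is a unital $^*$-subalgebra graded by $\Omega^{\rm ut}_{I;A}$. A cocycle twisted action (twisted action in the sense of Busby and Smith) of a group $G$ on a unital $^*$-algebra $B$ is a pair $(\alpha,m)$ of maps $\alpha:G\to\mathrm{Aut}(B)$ ($^*$-automorphisms) and $m:G\times G\to U_B$ such that $\alpha_e=\mathrm{id}$, $m(e,s)=m(s,e)=1$, $\alpha_s\alpha_t(b)=m(s,t)\alpha_{st}(b)m(s,t)^*$, and $\alpha_r(m(s,t))m(r,st)=m(r,s)m(rs,t)$ for all $r,s,t\in G$, $b\in B$. The algebraic crossed product $B\rtimes_{\alpha,m}G$ is the space of finitely supported functions $f:G\to B$ with $(fg)(t)=\sum_{s\in G}f(s)\alpha_s(g(s^{-1}t))m(s,s^{-1}t)$ and $f^*(t)=m(t,t^{-1})^*\alpha_t(f(t^{-1})^* )$, graded by $G$ (the component at $t$ consists of the functions supported on $\{t\}$). $\mathbb C[G]$ is the group $^*$-algebra with canonical basis $\{\lambda(g)\}_{g\in G}$, and $B\otimes\mathbb C[G]$ is graded by the subspaces $B\otimes\lambda(g)$. A graded $^*$-isomorphism is a $^*$-isomorphism preserving the grading. An abelian group $G$ is divisible if for all $g\in G$ and $n\in\mathbb N$ (positive integers) there is $h\in G$ with $h^n=g$. *)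

(* Defs.v *)
From HB Require Import structures.
From mathcomp Require Import all_boot all_order all_algebra finmap.
From mathcomp Require Import all_classical reals.
From mathcomp Require Import complex.

Set Implicit Arguments.
Unset Strict Implicit.
Unset Printing Implicit Defensive.

Import Order.TTheory GRing.Theory Num.Theory.

Local Open Scope classical_set_scope.
Local Open Scope ring_scope.

(* Unital *-algebras.  As an [algType] is a non-trivial ring, the algebras
   below are non-zero. *)
HB.mixin Record isStarAlgebra (C : numClosedFieldType) A of GRing.Algebra C A := {
  star : A -> A;
  starK : involutive star;
  star_conjlinear : forall (a : C) x y,
    star (a *: x + y) = Num.conj a *: star x + star y;
  starM : forall x y, star (x * y) = star y * star x
}.

#[short(type="starAlgType")]
HB.structure Definition StarAlgebra (C : numClosedFieldType) :=
  {A of isStarAlgebra C A & GRing.Algebra C A}.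

Section StarTheory.
Context {C : numClosedFieldType} {A : starAlgType C}.
Implicit Types x y : A.

Lemma starD : {morph (@star C A) : x y / x + y}.
Proof.
by move=> x y; rewrite -[x in LHS]scale1r star_conjlinear rmorph1 scale1r.
Qed.

Lemma star0 : star (0 : A) = 0.
Proof. by apply: (addrI (star (0 : A))); rewrite -starD !addr0. Qed.

Lemma starZ (a : C) x : star (a *: x) = Num.conj a *: star x.
Proof. by rewrite -[a *: x]addr0 star_conjlinear star0 addr0. Qed.

Lemma star1 : star (1 : A) = 1.
Proof. by rewrite -[LHS]mul1r -{1}[1](@starK C A) -starM mul1r starK. Qed.

End StarTheory.

Record star_hom (C : numClosedFieldType) (A B : starAlgType C) (f : A -> B)
    : Prop := StarHom {
  star_hom_linear : linear f;
  star_homM : {morph f : x y / x * y};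
  star_hom1 : f 1 = 1;
  star_homS : {morph f : x / star x}
}.

Definition star_iso (C : numClosedFieldType) (A B : starAlgType C)
  (f : A -> B) := star_hom f /\ bijective f.

(* A grading is given by its family of homogeneous components. *)
Definition graded_star_iso (C : numClosedFieldType) (A B : starAlgType C)
    (G : Type) (gA : G -> set A) (gB : G -> set B) (f : A -> B) :=
  star_iso f /\ forall g x, gA g x <-> gB g (f x).

Section StarHomTheory.
Context {C : numClosedFieldType} {A B : starAlgType C} {f : A -> B}.
Hypothesis hf : star_hom f.

Lemma star_homD : {morph f : x y / x + y}.
Proof.
by move=> x y; rewrite -[x in LHS]scale1r (star_hom_linear hf) scale1r.
Qed.

Lemma star_hom0 : f 0 = 0.
Proof. by apply: (addrI (f 0)); rewrite -star_homD !addr0. Qed.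

Lemma star_homZ (a : C) x : f (a *: x) = a *: f x.
Proof. by rewrite -[a *: x]addr0 (star_hom_linear hf) star_hom0 addr0. Qed.

End StarHomTheory.

Record star_subalg (C : numClosedFieldType) (A : starAlgType C) := StarSubalg {
  ss_pred : {pred A};
  ss_subalg : subalg_closed ss_pred;
  ss_star : {in ss_pred, forall x, star x \in ss_pred}
}.

Definition star_subalg_type (C : numClosedFieldType) (A : starAlgType C)
  (S : star_subalg A) := {x : A | x \in ss_pred S}.
Coercion star_subalg_type : star_subalg >-> Sortclass.

Section StarSubalg.
Context {C : numClosedFieldType} {A : starAlgType C} (S : star_subalg A).

HB.instance Definition _ :=
  GRing.isSubalgClosed.Build C A (ss_pred S) (ss_subalg S).
HB.instance Definition _ := SubType.on (star_subalg_type S).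
HB.instance Definition _ := Choice.on (star_subalg_type S).
HB.instance Definition _ :=
  [SubChoice_isSubAlgebra of (star_subalg_type S) by <:].

Definition ss_starfun (x : star_subalg_type S) : star_subalg_type S :=
  exist _ (star (val x)) (ss_star (valP x)).

Lemma ss_starK : involutive ss_starfun.
Proof. by move=> x; apply: val_inj; rewrite /= starK. Qed.
Lemma ss_star_conjlinear (a : C) (x y : star_subalg_type S) :
  ss_starfun (a *: x + y) = Num.conj a *: ss_starfun x + ss_starfun y.
Proof. by apply: val_inj; rewrite /= starD starZ. Qed.
Lemma ss_starM (x y : star_subalg_type S) :
  ss_starfun (x * y) = ss_starfun y * ss_starfun x.
Proof. by apply: val_inj; rewrite /= starM. Qed.

HB.instance Definition _ := isStarAlgebra.Build C (star_subalg_type S)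
  ss_starK ss_star_conjlinear ss_starM.

End StarSubalg.

Definition sub_grading (C : numClosedFieldType) (A : starAlgType C)
    (G : Type) (gA : G -> set A) (S : star_subalg A) (g : G) : set S :=
  [set x | gA g (val x)].
Arguments sub_grading {C A G} gA S g.

Section RegularStar.
Variable C : numClosedFieldType.

Lemma regular_starK : involutive (fun x : C^o => Num.conj x : C^o).
Proof. by move=> x; rewrite conjCK. Qed.
Lemma regular_star_conjlinear (a : C) (x y : C^o) :
  Num.conj (a *: x + y) = Num.conj a *: (Num.conj x : C^o) + Num.conj y :> C^o.
Proof. by rewrite rmorphD rmorphM. Qed.
Lemma regular_starM (x y : C^o) :
  Num.conj (x * y) = Num.conj y * Num.conj x :> C^o.
Proof. by rewrite rmorphM mulrC. Qed.

HB.instance Definition _ := isStarAlgebra.Build C C^o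
  regular_starK regular_star_conjlinear regular_starM.

End RegularStar.

Record unitary (C : numClosedFieldType) (A : starAlgType C) := Unitary {
  uval : A;
  uvalP : (star uval * uval == 1) && (uval * star uval == 1)
}.

Section UnitaryGroup.
Context {C : numClosedFieldType} {A : starAlgType C}.

HB.instance Definition _ := [isSub for @uval C A].
HB.instance Definition _ := [Choice of unitary A by <:].

Implicit Types u v : unitary A.

Lemma mulVu u : star (uval u) * uval u = 1.
Proof. by case/andP: (uvalP u) => /eqP. Qed.
Lemma muluV u : uval u * star (uval u) = 1.
Proof. by case/andP: (uvalP u) => _ /eqP. Qed.

Fact uone_subproof : (star (1 : A) * 1 == 1) && ((1 : A) * star (1 : A) == 1).
Proof. by rewrite star1 mulr1 eqxx. Qed.
Definition uone : unitary A := Unitary uone_subproof.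

Fact umul_subproof u v : (star (uval u * uval v) * (uval u * uval v) == 1) &&
  ((uval u * uval v) * star (uval u * uval v) == 1).
Proof.
rewrite starM !mulrA -(mulrA _ _ (uval u)) mulVu mulr1 mulVu.
by rewrite -(mulrA (uval u)) muluV mulr1 muluV eqxx.
Qed.
Definition umul u v : unitary A := Unitary (umul_subproof u v).

Fact uinv_subproof u : (star (star (uval u)) * star (uval u) == 1) &&
  (star (uval u) * star (star (uval u)) == 1).
Proof. by rewrite starK mulVu muluV eqxx. Qed.
Definition uinv u : unitary A := Unitary (uinv_subproof u).

Lemma umulA : associative umul.
Proof. by move=> u v w; apply: val_inj; rewrite /= mulrA. Qed.
Lemma umul1g : left_id uone umul.
Proof. by move=> u; apply: val_inj; rewrite /= mul1r. Qed.
Lemma umulg1 : right_id uone umul.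
Proof. by move=> u; apply: val_inj; rewrite /= mulr1. Qed.
Lemma umulVg : left_inverse uone uinv umul.
Proof. by move=> u; apply: val_inj; rewrite /= mulVu. Qed.
Lemma umulgV : right_inverse uone uinv umul.
Proof. by move=> u; apply: val_inj; rewrite /= muluV. Qed.

HB.instance Definition _ := isGroup.Build (unitary A)
  umulA umul1g umulg1 umulVg umulgV.

End UnitaryGroup.

Definition divisible (G : groupType) :=
  forall (g : G) (n : nat), (0 < n)%N -> exists h : G, (h ^+ n)%g = g.

Section UnitaryFamilies.
Context {C : numClosedFieldType} {I : choiceType}.
Variable A : I -> starAlgType C.

Definition ufam := forall i, unitary (A i).
HB.instance Definition _ := Choice.on ufam.

Definition cofin_eq (X : I -> Type) (x y : forall i, X i) :=
  finite_set [set i | x i <> y i].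

Lemma cofin_eq_refl (X : I -> Type) (x : forall i, X i) : cofin_eq x x.
Proof. by rewrite /cofin_eq (_ : mkset _ = set0) // -subset0 => i /=. Qed.

Lemma cofin_eq_sym (X : I -> Type) (x y : forall i, X i) :
  cofin_eq x y -> cofin_eq y x.
Proof. by apply: sub_finite_set => i /= /nesym. Qed.

Lemma cofin_eq_trans (X : I -> Type) (y x z : forall i, X i) :
  cofin_eq x y -> cofin_eq y z -> cofin_eq x z.
Proof.
move=> xy yz; have : finite_set ([set i | x i <> y i] `|` [set i | y i <> z i]).
  by rewrite finite_setU.
apply: sub_finite_set => i /= xz.
by have [xyi|] := pselect (x i = y i); [right; rewrite -xyi | left].
Qed.

Lemma cofin_eq_map (X Y : I -> Type) (f : forall i, X i -> Y i)
    (x y : forall i, X i) :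
  cofin_eq x y -> cofin_eq (fun i => f i (x i)) (fun i => f i (y i)).
Proof. by apply: sub_finite_set => i /= + xy; rewrite xy. Qed.

Lemma cofin_eq_map2 (X Y Z : I -> Type) (f : forall i, X i -> Y i -> Z i)
    (x x' : forall i, X i) (y y' : forall i, Y i) :
  cofin_eq x x' -> cofin_eq y y' ->
  cofin_eq (fun i => f i (x i) (y i)) (fun i => f i (x' i) (y' i)).
Proof.
move=> xx yy.
have : finite_set ([set i | x i <> x' i] `|` [set i | y i <> y' i]).
  by rewrite finite_setU.
apply: sub_finite_set => i /= n.
have [xi|] := pselect (x i = x' i); last by left.
by right=> yi; apply: n; rewrite xi yi.
Qed.

Definition ut_sim : rel ufam := fun u v => `[< cofin_eq u v >].

Lemma ut_sim_refl : reflexive ut_sim.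
Proof. by move=> u; apply/asboolP/cofin_eq_refl. Qed.
Lemma ut_sim_sym : symmetric ut_sim.
Proof. by move=> u v; apply/asboolP/asboolP; apply: cofin_eq_sym. Qed.
Lemma ut_sim_trans : transitive ut_sim.
Proof.
by move=> v u w /asboolP uv /asboolP vw; apply/asboolP/(cofin_eq_trans uv).
Qed.

Canonical ut_equiv := EquivRel ut_sim ut_sim_refl ut_sim_sym ut_sim_trans.

Definition Omega_ut := {eq_quot ut_equiv}%qT.
HB.instance Definition _ := Choice.on Omega_ut.

Definition ut_class (u : ufam) : Omega_ut := (\pi_({eq_quot ut_equiv}) u)%qT.
Definition ut_repr (w : Omega_ut) : ufam := repr (w : {eq_quot ut_equiv}%qT).

Lemma ut_classP u v : cofin_eq u v <-> ut_class u = ut_class v.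
Proof. by split=> [|/eqmodP/asboolP//] uv; apply/eqmodP/asboolP. Qed.

Lemma ut_reprK w : ut_class (ut_repr w) = w.
Proof. exact: reprK. Qed.

Lemma ut_repr_class u : cofin_eq (ut_repr (ut_class u)) u.
Proof. by apply/ut_classP; rewrite ut_reprK. Qed.

Definition ut_one : Omega_ut := ut_class (fun=> 1%g).
Definition ut_mul (v w : Omega_ut) : Omega_ut :=
  ut_class (fun i => ut_repr v i * ut_repr w i)%g.
Definition ut_inv (w : Omega_ut) : Omega_ut :=
  ut_class (fun i => (ut_repr w i)^-1)%g.

Lemma ut_mul_class u v :
  ut_mul (ut_class u) (ut_class v) = ut_class (fun i => u i * v i)%g.
Proof.
apply/ut_classP; apply: (@cofin_eq_map2 _ _ _ (fun i (x y : unitary (A i)) => x * y)%g);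
exact: ut_repr_class.
Qed.

Lemma ut_inv_class u : ut_inv (ut_class u) = ut_class (fun i => (u i)^-1)%g.
Proof.
apply/ut_classP; apply: (@cofin_eq_map _ _ (fun i (x : unitary (A i)) => x^-1)%g).
exact: ut_repr_class.
Qed.

Lemma ut_mulA : associative ut_mul.
Proof.
move=> u v w; rewrite -(ut_reprK u) -(ut_reprK v) -(ut_reprK w) !ut_mul_class.
by congr ut_class; apply/functional_extensionality_dep => i; rewrite mulgA.
Qed.
Lemma ut_mul1g : left_id ut_one ut_mul.
Proof.
move=> u; rewrite -(ut_reprK u) ut_mul_class.
by congr ut_class; apply/functional_extensionality_dep => i; rewrite mul1g.
Qed.
Lemma ut_mulg1 : right_id ut_one ut_mul.
Proof.
move=> u; rewrite -(ut_reprK u) ut_mul_class.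
by congr ut_class; apply/functional_extensionality_dep => i; rewrite mulg1.
Qed.
Lemma ut_mulVg : left_inverse ut_one ut_inv ut_mul.
Proof.
move=> u; rewrite -(ut_reprK u) ut_inv_class ut_mul_class.
by congr ut_class; apply/functional_extensionality_dep => i; rewrite mulVg.
Qed.
Lemma ut_mulgV : right_inverse ut_one ut_inv ut_mul.
Proof.
move=> u; rewrite -(ut_reprK u) ut_inv_class ut_mul_class.
by congr ut_class; apply/functional_extensionality_dep => i; rewrite mulgV.
Qed.

HB.instance Definition _ := isGroup.Build Omega_ut
  ut_mulA ut_mul1g ut_mulg1 ut_mulVg ut_mulgV.

End UnitaryFamilies.

Record twisted_action (C : numClosedFieldType) (G : groupType)
    (B : starAlgType C) := TwistedAction {
  act : G -> B -> B;
  coc : G -> G -> unitary B;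
  act_aut : forall s, star_iso (act s);
  act1 : forall b, act 1%g b = b;
  coc1l : forall s, coc 1%g s = 1%g;
  coc1r : forall s, coc s 1%g = 1%g;
  act_act : forall s t b, act s (act t b) =
    uval (coc s t) * act (s * t)%g b * star (uval (coc s t));
  cocycleP : forall r s t, act r (uval (coc s t)) * uval (coc r (s * t)%g) =
    uval (coc r s) * uval (coc (r * s)%g t)
}.

Section FiniteSupport.
Context {C : numClosedFieldType} {G : choiceType} {B : lmodType C}.

Definition finsupp : {pred G -> B} :=
  fun f => `[< finite_set [set t | f t <> 0] >].

Lemma finsuppP f : f \in finsupp <-> finite_set [set t | f t <> 0].
Proof. by split=> /asboolP. Qed.

Lemma finsupp_submod : submod_closed finsupp.
Proof.
split=> [|a f g /finsuppP ff /finsuppP fg]; apply/finsuppP.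
  by rewrite (_ : mkset _ = set0) // -subset0 => t /=.
have : finite_set ([set t | f t <> 0] `|` [set t | g t <> 0]).
  by rewrite finite_setU.
apply: sub_finite_set => t /= n.
have [ft|] := pselect (f t = 0); last by left.
by right=> gt; apply: n; rewrite /GRing.add /= /GRing.scale /= ft gt scaler0 addr0.
Qed.

HB.instance Definition _ :=
  GRing.isSubmodClosed.Build C (G -> B) finsupp finsupp_submod.

End FiniteSupport.

Definition crossed_product (C : numClosedFieldType) (G : groupType)
  (B : starAlgType C) (tw : twisted_action G B) := {f : G -> B | f \in finsupp}.

Section CrossedProduct.
Context {C : numClosedFieldType} {G : groupType} {B : starAlgType C}.
Variable tw : twisted_action G B.
Local Notation al := (act tw).
Local Notation m := (fun s t => uval (coc tw s t)).
Local Notation cp := (crossed_product tw).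

HB.instance Definition _ := SubType.on cp.
HB.instance Definition _ := Choice.on cp.
HB.instance Definition _ := [SubChoice_isSubLmodule of cp by <:].

Lemma cp_ext (f g : cp) : val f =1 val g -> f = g.
Proof. by move=> fg; apply/val_inj/funext. Qed.

Fact cp_delta_subproof (t : G) (b : B) :
  (fun s : G => if s == t then b else 0) \in finsupp.
Proof.
apply/finsuppP; apply: (@sub_finite_set _ _ [set t]); last exact: finite_set1.
by move=> s /=; case: eqP.
Qed.
Definition cp_delta (t : G) (b : B) : cp :=
  exist (fun h => h \in finsupp) _ (cp_delta_subproof t b).

Definition cp_mulfun (f g : G -> B) : G -> B := fun t =>
  \sum_(s \in [set: G]) f s * al s (g (s^-1 * t)%g) * m s (s^-1 * t)%g.

Definition cp_starfun (f : G -> B) : G -> B := fun t =>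
  star (m t (t^-1)%g) * al t (star (f (t^-1)%g)).

Fact cp_mul_subproof (f g : cp) : cp_mulfun (val f) (val g) \in finsupp.
Proof.
apply/finsuppP; have /finsuppP ff := valP f; have /finsuppP fg := valP g.
apply: (@sub_finite_set _ _ (image2 [set t | val f t <> 0]
  [set t | val g t <> 0] (fun s t => s * t)%g)); last exact: finite_image2.
move=> t /= n; have [s h] : exists s,
    val f s * al s (val g (s^-1 * t)%g) * m s (s^-1 * t)%g <> 0.
  apply: contrapT => /forallNP h; apply: n; apply: fsbig1 => s _.
  exact: contrapT (h s).
exists s; last exists (s^-1 * t)%g.
- by move=> fs; apply: h; rewrite /= fs !mul0r.
- move=> gs; apply: h; rewrite /= gs (star_hom0 (proj1 (act_aut tw s))).
  by rewrite mulr0 mul0r.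
- by rewrite mulVKg.
Qed.
Definition cp_mul (f g : cp) : cp :=
  exist (fun h => h \in finsupp) _ (cp_mul_subproof f g).

Fact cp_star_subproof (f : cp) : cp_starfun (val f) \in finsupp.
Proof.
apply/finsuppP; have /finsuppP ff := valP f.
apply: (@sub_finite_set _ _ ((fun t => t^-1)%g @` [set t | val f t <> 0]));
  last exact: finite_image.
move=> t /= h; exists (t^-1)%g; last by rewrite invgK.
move=> fs; apply: h; rewrite /cp_starfun fs star0.
by rewrite (star_hom0 (proj1 (act_aut tw t))) mulr0.
Qed.
Definition cp_star (f : cp) : cp :=
  exist (fun h => h \in finsupp) _ (cp_star_subproof f).

Lemma al0 s : al s 0 = 0.
Proof. exact: (star_hom0 (proj1 (act_aut tw s))). Qed.
Lemma alD s : {morph al s : x y / x + y}.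
Proof. exact: (star_homD (proj1 (act_aut tw s))). Qed.
Lemma alZ s (a : C) x : al s (a *: x) = a *: al s x.
Proof. exact: (star_homZ (proj1 (act_aut tw s))). Qed.
Lemma alM s : {morph al s : x y / x * y}.
Proof. exact: (star_homM (proj1 (act_aut tw s))). Qed.
Lemma al1 s : al s 1 = 1.
Proof. exact: (star_hom1 (proj1 (act_aut tw s))). Qed.
Lemma alS s : {morph al s : x / star x}.
Proof. exact: (star_homS (proj1 (act_aut tw s))). Qed.

Lemma cp_mulfunE (D : {fset G}) (f g : G -> B) t :
  (forall s, s \notin D -> f s = 0) ->
  cp_mulfun f g t =
  \sum_(s <- D) f s * al s (g (s^-1 * t)%g) * m s (s^-1 * t)%g.
Proof. by move=> Df; apply: fsbigTE => s /Df ->; rewrite !mul0r. Qed.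

Lemma cp_out (f : cp) s :
  s \notin fset_set [set s | val f s <> 0] -> val f s = 0.
Proof.
have /finsuppP ff := valP f; rewrite in_fset_set // => /negP h.
by apply: contrapT => n; apply: h; rewrite inE.
Qed.

Lemma cp_mul_linl (a : C) (f1 f2 g : cp) :
  cp_mul (a *: f1 + f2) g = a *: cp_mul f1 g + cp_mul f2 g.
Proof.
apply: cp_ext => t /=; rewrite !addrfctE !scalrfctE.
pose D := (fset_set [set s | val f1 s <> 0]%classic `|`
           fset_set [set s | val f2 s <> 0]%classic)%fset.
have D1 s : s \notin D -> val f1 s = 0.
  by rewrite in_fsetU negb_or => /andP[/cp_out].
have D2 s : s \notin D -> val f2 s = 0.
  by rewrite in_fsetU negb_or => /andP[_ /cp_out].
rewrite (cp_mulfunE _ _ D1) (cp_mulfunE _ _ D2) (@cp_mulfunE D); last first.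
  move=> s sD; transitivity (a *: val f1 s + val f2 s); first by [].
  by rewrite D1 // D2 // scaler0 addr0.
rewrite scaler_sumr -big_split /=; apply: eq_bigr => s _.
by rewrite !mulrDl !scalerAl.
Qed.

Lemma cp_mul_linr (a : C) (f g1 g2 : cp) :
  cp_mul f (a *: g1 + g2) = a *: cp_mul f g1 + cp_mul f g2.
Proof.
apply: cp_ext => t /=; rewrite !addrfctE !scalrfctE !(cp_mulfunE _ _ (@cp_out f)).
rewrite scaler_sumr -big_split /=; apply: eq_bigr => s _.
by rewrite alD alZ mulrDr mulrDl -scalerAr -scalerAl.
Qed.

Lemma cp_mulDl : left_distributive cp_mul +%R.
Proof. by move=> f g h; rewrite -[f in LHS]scale1r cp_mul_linl scale1r. Qed.
Lemma cp_mulDr : right_distributive cp_mul +%R.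
Proof. by move=> f g h; rewrite -[g in LHS]scale1r cp_mul_linr scale1r. Qed.
Lemma cp_mul0l : left_zero 0 cp_mul.
Proof. by move=> f; apply: (addrI (cp_mul 0 f)); rewrite -cp_mulDl !addr0. Qed.
Lemma cp_mul0r : right_zero 0 cp_mul.
Proof. by move=> f; apply: (addrI (cp_mul f 0)); rewrite -cp_mulDr !addr0. Qed.
Lemma cp_mulZl (a : C) (f g : cp) : cp_mul (a *: f) g = a *: cp_mul f g.
Proof. by rewrite -[a *: f]addr0 cp_mul_linl cp_mul0l addr0. Qed.
Lemma cp_mulZr (a : C) (f g : cp) : cp_mul f (a *: g) = a *: cp_mul f g.
Proof. by rewrite -[a *: g]addr0 cp_mul_linr cp_mul0r addr0. Qed.

Lemma cp_star_conjlinear (a : C) (f g : cp) :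
  cp_star (a *: f + g) = Num.conj a *: cp_star f + cp_star g.
Proof.
apply: cp_ext => t; transitivity (star (m t (t^-1)%g) *
  al t (star (a *: val f (t^-1)%g + val g (t^-1)%g))); first by [].
by rewrite starD starZ alD alZ mulrDr -scalerAr.
Qed.

Lemma cp_starD : {morph cp_star : f g / f + g}.
Proof.
by move=> f g; rewrite -[f in LHS]scale1r cp_star_conjlinear rmorph1 scale1r.
Qed.
Lemma cp_star0 : cp_star 0 = 0.
Proof. by apply: (addrI (cp_star 0)); rewrite -cp_starD !addr0. Qed.

Lemma cp_mul_delta s t b c :
  cp_mul (cp_delta s b) (cp_delta t c) =
  cp_delta (s * t)%g (b * al s c * m s t).
Proof.
apply: cp_ext => r /=.
rewrite (@cp_mulfunE [fset s]%fset) /=; last first.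
  by move=> i; rewrite in_fset1 => /negbTE ->.
rewrite big_seq_fset1 eqxx; have [->|rst] := eqVneq r (s * t)%g.
  by rewrite mulKg eqxx.
case: eqP => [e|_]; last by rewrite al0 mulr0 mul0r.
by move/eqP: rst; rewrite -e mulVKg.
Qed.

Lemma cp_star_delta t b :
  cp_star (cp_delta t b) =
  cp_delta (t^-1)%g (star (m (t^-1)%g t) * al (t^-1)%g (star b)).
Proof.
apply: cp_ext => r /=; rewrite /cp_starfun.
have [->|rt] := eqVneq r (t^-1)%g; first by rewrite invgK eqxx.
case: eqP => [e|_]; last by rewrite star0 al0 mulr0.
by move/eqP: rt; rewrite -e invgK.
Qed.

Lemma cp_ind (P : cp -> Prop) :
  P 0 -> (forall t b, P (cp_delta t b)) ->
  (forall f g, P f -> P g -> P (f + g)) -> forall f, P f.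
Proof.
move=> P0 Pd PD f; have /finsuppP ff := valP f.
have -> : f = \sum_(t <- fset_set [set s | val f s <> 0]) cp_delta t (val f t).
  apply: cp_ext => r; rewrite [in RHS]raddf_sum /=.
  have -> (q : seq G) : (\sum_(t <- q) val (cp_delta t (val f t))) r =
      \sum_(t <- q) val (cp_delta t (val f t)) r.
    by elim: q => [|t q IH]; rewrite ?big_nil // !big_cons -IH.
  have [fr|fr] := pselect (val f r = 0).
    by rewrite fr big1 // => t _ /=; case: eqP => // <-.
  rewrite (big_fsetD1 r) /=; last by rewrite in_fset_set // inE.
  rewrite eqxx big_seq big1 ?addr0 // => t.
  by rewrite in_fsetD1 eq_sym => /andP[/negbTE -> _].
by elim: (X in \sum_(t <- X) _) => [|t q IH]; rewrite ?big_nil // big_cons; apply: PD.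
Qed.

Lemma mSm s t : star (m s t) * m s t = 1.
Proof. exact: mulVu. Qed.
Lemma mmS s t : m s t * star (m s t) = 1.
Proof. exact: muluV. Qed.

Lemma cp_mulA : associative cp_mul.
Proof.
move=> f g h; elim/cp_ind: f => [|r b|f f' IH IH']; first by rewrite !cp_mul0l.
2: by rewrite !cp_mulDl IH IH'.
elim/cp_ind: g => [|s c|f f' IH IH']; first by rewrite !(cp_mul0l, cp_mul0r).
2: by rewrite !(cp_mulDl, cp_mulDr) IH IH'.
elim/cp_ind: h => [|t d|f f' IH IH']; first by rewrite !cp_mul0r.
2: by rewrite !cp_mulDr IH IH'.
rewrite !cp_mul_delta mulgA; congr cp_delta.
rewrite !alM act_act -!mulrA cocycleP.
by rewrite (mulrA (star _) (m r s)) mSm mul1r.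
Qed.

Lemma cp_mul1l : left_id (cp_delta 1%g 1) cp_mul.
Proof.
move=> f; elim/cp_ind: f => [|s b|f g IH IH']; first exact: cp_mul0r.
  by rewrite cp_mul_delta mul1g mul1r act1 coc1l mulr1.
by rewrite cp_mulDr IH IH'.
Qed.
Lemma cp_mul1r : right_id (cp_delta 1%g 1) cp_mul.
Proof.
move=> f; elim/cp_ind: f => [|s b|f g IH IH']; first exact: cp_mul0l.
  by rewrite cp_mul_delta mulg1 al1 mulr1 coc1r mulr1.
by rewrite cp_mulDl IH IH'.
Qed.

Lemma cp_one_neq0 : cp_delta 1%g 1 != 0.
Proof.
apply/eqP => /(congr1 (fun f : cp => val f 1%g)) /=; rewrite eqxx => /eqP.
by rewrite oner_eq0.
Qed.

HB.instance Definition _ := GRing.Zmodule_isNzRing.Build cp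
  cp_mulA cp_mul1l cp_mul1r cp_mulDl cp_mulDr cp_one_neq0.
HB.instance Definition _ := GRing.Lmodule_isLalgebra.Build C cp
  (fun a f g => esym (cp_mulZl a f g)).
HB.instance Definition _ := GRing.Lalgebra_isAlgebra.Build C cp
  (fun a f g => esym (cp_mulZr a f g)).

Lemma cp_starK : involutive cp_star.
Proof.
move=> f; elim/cp_ind: f => [|t b|f g IH IH']; first by rewrite !cp_star0.
2: by rewrite !cp_starD IH IH'.
rewrite !cp_star_delta invgK; congr cp_delta.
rewrite starM starK alM -alS starK act_act mulgV act1.
have := cocycleP tw t (t^-1)%g t.
rewrite mulVg mulgV coc1l coc1r /= !mulr1 => ->.
by rewrite -!mulrA mSm mulr1 !mulrA mSm mul1r.
Qed.

Lemma cp_starM (f g : cp) : cp_star (f * g) = cp_star g * cp_star f.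
Proof.
elim/cp_ind: f => [|s b|f f' IH IH'].
- by rewrite mul0r !cp_star0 mulr0.
2: by rewrite mulrDl !cp_starD mulrDr IH IH'.
elim/cp_ind: g => [|t c|f f' IH IH'].
- by rewrite mulr0 !cp_star0 mul0r.
2: by rewrite mulrDr !cp_starD mulrDl IH IH'.
rewrite /GRing.mul /= !cp_mul_delta !cp_star_delta cp_mul_delta invgM.
congr cp_delta.
set t' := (t^-1)%g; set s' := (s^-1)%g; set p := (t' * s')%g.
have ps : (p * s = t')%g by rewrite /p /s' mulgVK.
have E1 : m p s = star (m t' s') * al t' (m s' s).
  have := cocycleP tw t' s' s; rewrite mulVg coc1r /= mulr1 => ->.
  by rewrite mulrA mSm mul1r.
have E2 : star (m p (s * t)%g) * star (al p (m s t)) =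
    star (m t' t) * star (m p s).
  by rewrite -!starM cocycleP ps.
rewrite !starM !alM !alS mulrA E2 act_act ps !starM starK !mulrA.
rewrite -(mulrA _ (star (m p s)) (m p s)) mSm mulr1.
rewrite -!mulrA; congr (_ * (_ * _)).
rewrite act_act -/p {1}E1 !starM starK -!mulrA.
by rewrite mSm mulr1.
Qed.

HB.instance Definition _ := isStarAlgebra.Build C cp
  cp_starK cp_star_conjlinear cp_starM.

Definition cp_grading (t : G) : set cp :=
  [set f | forall s, s != t -> val f s = 0].

End CrossedProduct.

Arguments cp_grading {C G B} tw t.

Section TrivialAction.
Variables (C : numClosedFieldType) (G : groupType) (B : starAlgType C).

Fact trivial_act_aut (s : G) : star_iso (fun b : B => b).
Proof. by split; [split | exists id]. Qed.
Fact trivial_act_act (s t : G) (b : B) :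
  b = uval (1%g : unitary B) * b * star (uval (1%g : unitary B)).
Proof. by rewrite /= star1 mul1r mulr1. Qed.

Definition trivial_action : twisted_action G B :=
  @TwistedAction C G B (fun _ b => b) (fun _ _ => 1%g) trivial_act_aut
    (fun _ => erefl) (fun _ => erefl) (fun _ => erefl)
    trivial_act_act (fun _ _ _ => erefl).

End TrivialAction.

(* With the trivial action on C the crossed product formulas become
   (f g)(t) = \sum_s f(s) g(s^-1 t) and f^*(t) = (f(t^-1))^*. *)
Definition group_alg (C : numClosedFieldType) (G : groupType) :=
  crossed_product (trivial_action G C^o).
HB.instance Definition _ (C : numClosedFieldType) (G : groupType) :=
  StarAlgebra.on (group_alg C G).

Definition group_alg_basis (C : numClosedFieldType) (G : groupType) (g : G) :
  group_alg C G := cp_delta _ g 1.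

Section Span.
Context {C : numClosedFieldType} {V : lmodType C}.
Implicit Types S : set V.

Definition lspan S : set V :=
  [set v | exists2 r : seq (C * V),
    (forall p, p \in r -> S p.2) & v = \sum_(p <- r) p.1 *: p.2].

Lemma lspan_sub S : S `<=` lspan S.
Proof.
move=> v Sv; exists [:: (1, v)]; first by move=> p; rewrite inE => /eqP ->.
by rewrite big_seq1 scale1r.
Qed.

Lemma lspan0 S : lspan S 0.
Proof. by exists [::] => //; rewrite big_nil. Qed.

Lemma lspanD S u v : lspan S u -> lspan S v -> lspan S (u + v).
Proof.
move=> [r rS ->] [q qS ->]; exists (r ++ q); last by rewrite big_cat.
by move=> p; rewrite mem_cat => /orP[/rS|/qS].
Qed.

Lemma lspanZ S (a : C) u : lspan S u -> lspan S (a *: u).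
Proof.
move=> [r rS ->]; exists [seq (a * p.1, p.2) | p <- r].
  by move=> _ /mapP[p /rS Sp ->].
by rewrite big_map scaler_sumr; apply: eq_bigr => p _; rewrite scalerA.
Qed.

Lemma lspan_ind S (P : V -> Prop) : P 0 ->
  (forall (a : C) u v, S u -> P v -> P (a *: u + v)) ->
  forall v, lspan S v -> P v.
Proof.
move=> P0 PD v [r rS ->]; elim: r rS => [|p r IH] rS; first by rewrite big_nil.
rewrite big_cons; apply: PD; first by apply: rS; rewrite inE eqxx.
by apply: IH => q qr; apply: rS; rewrite inE qr orbT.
Qed.

End Span.

Lemma lspan_subalg (C : numClosedFieldType) (A : starAlgType C) (S : set A) :
  S 1 -> (forall x y, S x -> S y -> S (x * y)) ->
  subalg_closed (fun x => `[< lspan S x >] : bool).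
Proof.
move=> S1 SM; split; first by apply/asboolP/lspan_sub.
  move=> a u v /asboolP Su /asboolP Sv; apply/asboolP/lspanD => //.
  exact: lspanZ.
move=> x y /asboolP Sx /asboolP Sy; apply/asboolP.
move: x Sx; apply: lspan_ind => [|a x x' Sx IH].
  by rewrite mul0r; apply: lspan0.
rewrite mulrDl -scalerAl; apply: lspanD => //; apply: lspanZ => {x' IH}.
move: y Sy; apply: lspan_ind => [|b y y' Sy IH].
  by rewrite mulr0; apply: lspan0.
rewrite mulrDr -scalerAr; apply: lspanD => //; apply: lspanZ.
exact/lspan_sub/SM.
Qed.

Lemma lspan_star (C : numClosedFieldType) (A : starAlgType C) (S : set A) :
  (forall x, S x -> S (star x)) ->
  {in (fun x => `[< lspan S x >] : bool), forall x,
    star x \in (fun x => `[< lspan S x >] : bool)}.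
Proof.
move=> SS x /asboolP Sx; apply/asboolP.
move: x Sx; apply: lspan_ind => [|a x x' Sx IH].
  by rewrite star0; apply: lspan0.
rewrite star_conjlinear; apply: lspanD => //.
exact/lspanZ/lspan_sub/SS.
Qed.

Definition multilinear (C : numClosedFieldType) (I : choiceType)
    (X : I -> lmodType C) (W : lmodType C) (f : (forall i, X i) -> W) :=
  forall (x : forall i, X i) (i : I), linear (fun v : X i => f (dfwith x i v)).

(* [Theta x] is the elementary tensor of the family x. *)
Record is_itensor (C : numClosedFieldType) (I : choiceType)
    (X : I -> lmodType C) (T : lmodType C) (Theta : (forall i, X i) -> T)
    : Prop := IsITensor {
  itensor_multilinear : multilinear Theta;
  itensor_universal : forall (W : lmodType C) (f : (forall i, X i) -> W),
    multilinear f -> exists g : T -> W,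
    [/\ linear g, forall x, g (Theta x) = f x &
        forall h : T -> W, linear h -> (forall x, h (Theta x) = f x) -> h =1 g]
}.

Record is_star_itensor (C : numClosedFieldType) (I : choiceType)
    (A : I -> starAlgType C) (T : starAlgType C)
    (Theta : (forall i, A i) -> T) : Prop := IsStarITensor {
  star_itensor_tensor : is_itensor (X := fun i => A i) Theta;
  star_itensorM : forall a b,
    Theta a * Theta b = Theta (fun i => a i * b i);
  star_itensorS : forall a, star (Theta a) = Theta (fun i => star (a i))
}.

Definition bilinear2 (C : numClosedFieldType) (V W Z : lmodType C)
    (f : V -> W -> Z) :=
  (forall v, linear (f v)) /\ (forall w, linear (f^~ w)).

Record is_tensor (C : numClosedFieldType) (V W T : lmodType C)
    (tau : V -> W -> T) : Prop := IsTensor {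
  tensor_bilinear : bilinear2 tau;
  tensor_universal : forall (Z : lmodType C) (f : V -> W -> Z),
    bilinear2 f -> exists g : T -> Z,
    [/\ linear g, forall v w, g (tau v w) = f v w &
        forall h : T -> Z, linear h -> (forall v w, h (tau v w) = f v w) ->
          h =1 g]
}.

Record is_star_tensor (C : numClosedFieldType) (A B T : starAlgType C)
    (tau : A -> B -> T) : Prop := IsStarTensor {
  star_tensor_tensor : is_tensor tau;
  star_tensorM : forall a a' b b', tau a b * tau a' b' = tau (a * a') (b * b');
  star_tensorS : forall a b, star (tau a b) = tau (star a) (star b)
}.

(* The components B (x) lambda(g) of P = B (x) C[G]. *)
Definition tensor_group_alg_grading (C : numClosedFieldType) (G : groupType)
    (B P : starAlgType C) (tau : B -> group_alg C G -> P) (g : G) : set P :=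
  range (fun b : B => tau b (group_alg_basis C g)).

Section InfiniteTensor.
Context {C : numClosedFieldType} {I : choiceType} {A : I -> starAlgType C}.
Context {T : starAlgType C} {Theta : (forall i, A i) -> T}.

Definition tensor_at (u : forall i, A i) : set T :=
  lspan (Theta @` [set x | cofin_eq x u]).

Lemma tensor_at_sim u v : cofin_eq u v -> tensor_at u = tensor_at v.
Proof.
move=> uv; congr (lspan (_ @` _)); apply/seteqP; split=> x /= xu.
  exact: cofin_eq_trans xu uv.
exact: cofin_eq_trans xu (cofin_eq_sym uv).
Qed.

(* Independent of the representative: see [tensor_comp_class]. *)
Definition tensor_comp (w : Omega_ut A) : set T :=
  tensor_at (fun i => uval (ut_repr w i)).

Lemma tensor_comp_class (u : ufam A) :
  tensor_comp (ut_class u) = tensor_at (fun i => uval (u i)).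
Proof.
apply: tensor_at_sim; apply: (@cofin_eq_map _ _ _ (fun i => @uval C (A i))).
exact: ut_repr_class.
Qed.

Hypothesis HT : is_star_itensor Theta.

Lemma itensor1 : Theta (fun=> 1) = 1.
Proof.
have Hml := itensor_multilinear (star_itensor_tensor HT).
have [g [gl gT gU]] := itensor_universal (star_itensor_tensor HT) Hml.
have -> : Theta (fun=> 1) = Theta (fun=> 1) * 1 by rewrite mulr1.
rewrite -[RHS]/(idfun (1 : T)) [RHS](gU idfun) //.
rewrite -[LHS]/((fun x => Theta (fun=> 1) * x) 1); apply: gU.
  by move=> a x y; rewrite mulrDr scalerAr.
move=> x; rewrite (star_itensorM HT); congr Theta.
by apply/functional_extensionality_dep => i; rewrite mul1r.
Qed.

Lemma tensor_atM u v x y : tensor_at u x -> tensor_at v y ->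
  tensor_at (fun i => u i * v i) (x * y).
Proof.
move=> Sx Sy.
move: x Sx; apply: lspan_ind => [|a x x' [x0 xu <-] IH].
  by rewrite mul0r; apply: lspan0.
rewrite mulrDl -scalerAl; apply: lspanD => //; apply: lspanZ => {x' IH}.
move: y Sy; apply: lspan_ind => [|b y y' [y0 yv <-] IH].
  by rewrite mulr0; apply: lspan0.
rewrite mulrDr -scalerAr; apply: lspanD => //; apply: lspanZ.
rewrite (star_itensorM HT); apply: lspan_sub; eexists; last by [].
exact: (@cofin_eq_map2 _ _ _ _ (fun i (x y : A i) => x * y)).
Qed.

Lemma tensor_atS u x : tensor_at u x ->
  tensor_at (fun i => star (u i)) (star x).
Proof.
move: x; apply: lspan_ind => [|a x x' [x0 xu <-] IH].
  by rewrite star0; apply: lspan0.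
rewrite star_conjlinear; apply: lspanD => //; apply: lspanZ.
rewrite (star_itensorS HT); apply: lspan_sub; eexists; last by [].
exact: (@cofin_eq_map _ _ _ (fun i (x : A i) => star x)).
Qed.

Fact tensor_e_subalg :
  subalg_closed (fun x => `[< tensor_at (fun=> 1) x >] : bool).
Proof.
apply: lspan_subalg.
  by exists (fun=> 1); [apply: cofin_eq_refl | apply: itensor1].
move=> _ _ [a a1 <-] [b b1 <-]; exists (fun i => a i * b i).
  apply: (@cofin_eq_trans _ _ (fun i => 1 * 1)).
    exact: (@cofin_eq_map2 _ _ _ _ (fun i (x y : A i) => x * y)).
  by rewrite /cofin_eq (_ : mkset _ = set0) // -subset0 => i /=; rewrite mulr1.
by rewrite (star_itensorM HT).
Qed.

Fact tensor_e_star : {in (fun x => `[< tensor_at (fun=> 1) x >] : bool),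
  forall x, star x \in (fun x => `[< tensor_at (fun=> 1) x >] : bool)}.
Proof.
apply: lspan_star => _ [a a1 <-]; exists (fun i => star (a i)).
  apply: (@cofin_eq_trans _ _ (fun i => star 1)).
    exact: (@cofin_eq_map _ _ _ (fun i (x : A i) => star x)).
  by rewrite /cofin_eq (_ : mkset _ = set0) // -subset0 => i /=; rewrite star1.
by rewrite (star_itensorS HT).
Qed.

Definition tensor_e : star_subalg T := StarSubalg tensor_e_subalg tensor_e_star.

(* The sum of the components is automatically direct in the tensor product. *)
Definition tensor_ut_set : set T :=
  lspan (\bigcup_(w in [set: Omega_ut A]) tensor_comp w).

Fact tensor_ut_subalg : subalg_closed (fun x => `[< tensor_ut_set x >] : bool).
Proof.
apply: lspan_subalg.
  exists 1%g => //; rewrite tensor_comp_class; apply: lspan_sub.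
  by exists (fun=> 1); [apply: cofin_eq_refl | apply: itensor1].
move=> x y [v _ xv] [w _ yw]; exists (v * w)%g => //.
by rewrite tensor_comp_class; apply: (tensor_atM xv yw).
Qed.

Fact tensor_ut_star : {in (fun x => `[< tensor_ut_set x >] : bool),
  forall x, star x \in (fun x => `[< tensor_ut_set x >] : bool)}.
Proof.
apply: lspan_star => x [w _ xw]; exists (w^-1)%g => //.
by rewrite tensor_comp_class; apply: (tensor_atS xw).
Qed.

Definition tensor_ut : star_subalg T :=
  StarSubalg tensor_ut_subalg tensor_ut_star.

Definition tensor_ut_grading : Omega_ut A -> set tensor_ut :=
  sub_grading tensor_comp tensor_ut.

End InfiniteTensor.

Arguments tensor_at {C I A T} Theta u.
Arguments tensor_comp {C I A T} Theta w.
Arguments tensor_e {C I A T Theta} HT.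
Arguments tensor_ut {C I A T Theta} HT.
Arguments tensor_ut_grading {C I A T Theta} HT w.

(* Main.v *)
From HB Require Import structures.
Require Import Defs.
From mathcomp Require Import all_boot all_order all_algebra finmap.
From mathcomp Require Import all_classical reals.
From mathcomp Require Import complex.

Set Implicit Arguments.
Unset Strict Implicit.
Unset Printing Implicit Defensive.

Import GRing.Theory Num.Theory.

Local Open Scope classical_set_scope.
Local Open Scope ring_scope.

(* Choose a section w |-> c w of the quotient map from families of unitaries to
   Omega, with c 1 = 1.  The unitaries W w = Theta (c w) are homogeneous of
   degree w, so conjugation by W s and the cocycle W s W t (W (s t))^* form a
   twisted action on the unit component and f |-> \sum_t f(t) W t is the graded
   isomorphism from its crossed product; it is injective because the universal
   property provides projections of T onto the components.

   In the commutative case the conjugations are trivial.  The homomorphism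
   u |-> iota (Theta u), defined on the families u that are almost everywhere 1,
   extends to a homomorphism chi from all families of unitaries to the divisible
   group U_B, and w |-> chi (c w) exhibits the cocycle as a coboundary in U_B.
   Hence f |-> (t |-> iota (f t) chi (c t)) maps the twisted crossed product
   into the untwisted one over B, which is B (x) C[Omega]. *)

(** * Extending homomorphisms into divisible abelian groups *)

Section DivisibleExtension.
Variables (G D : groupType).
Hypotheses (commG : forall x y : G, (x * y = y * x)%g)
  (commD : forall x y : D, (x * y = y * x)%g) (divD : divisible D).

(* Partial homomorphisms are handled through their graphs.  The last clause is
   vacuous for the empty relation, which makes the union of the empty chain
   admissible in Zorn's lemma. *)
Record partial_hom (base R : set (G * D)) : Prop := PartialHom {
  phomM : forall x y, R x -> R y -> R (x.1 * y.1, x.2 * y.2)%g;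
  phomV : forall x, R x -> R (x.1^-1, x.2^-1)%g;
  phom1 : forall d, R (1%g, d) -> d = 1%g;
  phom_base : forall x, R x -> base `<=` R
}.

(** Each clause involves at most two elements of the union, and totality of the chain places both in
    one member. *)
Lemma partial_hom_chain (base : set (G * D)) (F : set (set (G * D))) :
  F `<=` partial_hom base -> total_on F subset ->
  partial_hom base (\bigcup_(X in F) X).
Proof.
move=> FP Ftot; split.
- move=> x y [X FX Xx] [Y FY Yy]; have [XY|YX] := Ftot X Y FX FY.
  + by exists Y => //; apply: (phomM (FP _ FY)) => //; apply: XY.
  + by exists X => //; apply: (phomM (FP _ FX)) => //; apply: YX.
- by move=> x [X FX Xx]; exists X => //; apply: (phomV (FP _ FX)).
- by move=> d [X FX Xd]; apply: (phom1 (FP _ FX)).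
- by move=> x [X FX Xx] b bb; exists X => //; apply: (phom_base (FP _ FX) Xx).
Qed.

Section OneStep.
Variables (base R : set (G * D)).
Hypotheses (PR : partial_hom base R) (R1 : R (1, 1)%g).

Lemma phomX x n : R x -> R (x.1 ^+ n, x.2 ^+ n)%g.
Proof.
move=> Rx; elim: n => [|n IH]; first by rewrite !expg0.
by rewrite !expgS; apply: (phomM PR Rx IH).
Qed.

(** The exponents [k] for which [g ^+ k] lies in the domain of [R] are the multiples of the least
    positive one, [n]. Divisibility supplies [h] as an [n]-th root of the value at [g ^+ n]; if no
    positive exponent occurs, [h = 1] serves. *)
Lemma divisible_value (g : G) :
  exists h : D, forall k d, R ((g ^+ k)%g, d) -> d = (h ^+ k)%g.
Proof.
pose P n := `[< (0 < n)%N /\ exists d, R ((g ^+ n)%g, d) >].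
have [exP|nP] := pselect (exists n, P n); last first.
  exists 1%g => -[|k] d Rd; first exact: (phom1 PR).
  by case: nP; exists k.+1; apply/asboolP; split=> //; exists d.
case: (ex_minnP exP) => n /asboolP[n0 [d0 Rn]] minn.
have [h hn] := divD d0 n0; exists h => k d Rk.
(* Division with remainder: minimality of [n] will force the exponent [k %% n] to vanish. *)
have Rr : R ((g ^+ (k %% n))%g, (d * (d0 ^+ (k %/ n))^-1)%g).
  have := phomM PR Rk (phomV PR (phomX (k %/ n) Rn)).
  rewrite /= -expgnA mulnC {1}(divn_eq k n) addnC expgnDr mulgK.
  by [].
have r0 : (k %% n = 0)%N.
  have [//|r0] := posnP (k %% n)%N.
  suff /minn : P (k %% n)%N by rewrite leqNgt ltn_pmod.
  by apply/asboolP; split=> //; eexists; exact: Rr.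
move: Rr; rewrite r0 expg0 => /(phom1 PR) /divg1_eq ->.
by rewrite -hn -expgnA mulnC {2}(divn_eq k n) r0 addn0.
Qed.

(** The domain grows to the subgroup it generates together with [g], and [g] is sent to the [h] of
    [divisible_value]. *)
Lemma partial_hom_extend (g : G) : exists h R', [/\ partial_hom base R',
  R `<=` R' & R' (g, h)].
Proof.
have [h hP] := divisible_value g; exists h.
(* This encodes [x] as [a] times the power [k - j] of the pair [g, h]; two natural exponents stand
   for an integer one. *)
pose R' := [set x | exists j k a, [/\ R a, (x.1 * g ^+ j = a.1 * g ^+ k)%g
                                   & (x.2 * h ^+ j = a.2 * h ^+ k)%g]].
have RR' : R `<=` R' by move=> x Rx; exists 0%N, 0%N, x.
exists R'.
have mul4 (K : groupType) : (forall x y : K, (x * y = y * x)%g) ->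
    forall x y z t : K, (x * y * (z * t) = x * z * (y * t))%g.
  by move=> cK x y z t; rewrite !mulgA -(mulgA x) (cK y) mulgA.
have mulV (K : groupType) : (forall x y : K, (x * y = y * x)%g) ->
    forall x y z t : K, (x * y = z * t -> x^-1 * t = z^-1 * y)%g.
  move=> cK x y z t e; apply: (@mulgI _ x); rewrite mulVKg; apply: (@mulgI _ z).
  by rewrite -e mulgA (cK z x) -mulgA mulVKg.
split=> //; last first.
  by exists 0%N, 1%N, (1, 1)%g; rewrite /= !expg0 !expg1 !mulg1 !mul1g.
split.
- move=> x y [j [k [a [Ra ax1 ax2]]]] [j' [k' [b [Rb bx1 bx2]]]].
  exists (j + j')%N, (k + k')%N, (a.1 * b.1, a.2 * b.2)%g.
  split; first exact: (phomM PR).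
  + by rewrite /= !expgnDr [LHS](mul4 G) // [RHS](mul4 G) // ax1 bx1.
  + by rewrite /= !expgnDr [LHS](mul4 D) // [RHS](mul4 D) // ax2 bx2.
- move=> x [j [k [a [Ra ax1 ax2]]]].
  exists k, j, (a.1^-1, a.2^-1)%g; split; first exact: (phomV PR).
  + exact: mulV.
  + exact: mulV.
(* Single-valuedness: after cancelling the smaller exponent, [a.1] or its inverse is a power of [g],
   and [h] matches [R] on such powers. *)
- move=> d [j [k [a [Ra /=]]]]; rewrite mul1g => a1 a2.
  have [kj|/ltnW jk] := leqP k j.
    move: a1 a2; rewrite -(subnK kj) !expgnDr mulgA.
    move=> /mulIg a1 /mulIg a2; move: Ra; rewrite [a]surjective_pairing -a1.
    by move=> /hP /= e; move: a2; rewrite e -[RHS]mul1g => /mulIg.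
  move: a1 a2; rewrite -(subnK jk) !expgnDr -{1}[(g ^+ j)%g]mul1g !mulgA.
  move=> /mulIg a1 /mulIg ->.
  have /= := phomV PR Ra.
  have -> : (a.1^-1 = g ^+ (k - j))%g by apply: (@mulgI _ a.1); rewrite mulgV.
  by move=> /hP <-; rewrite mulgV.
- by move=> x _ b bb; apply: RR'; apply: (phom_base PR R1).
Qed.

End OneStep.

(** Zorn's lemma yields a maximal partial homomorphism; one-step extension makes it total, and the
    clause on the identity makes it a function. *)
Lemma divisible_hom_extension (N : set G) (f : G -> D) :
  N 1%g -> (forall x y, N x -> N y -> N (x * y)%g) ->
  (forall x, N x -> N (x^-1)%g) ->
  (forall x y, N x -> N y -> f (x * y)%g = (f x * f y)%g) ->
  exists F : G -> D, (forall x y, F (x * y)%g = (F x * F y)%g) /\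
    forall x, N x -> F x = f x.
Proof.
move=> N1 NM NV fM.
have f1 : f 1%g = 1%g.
  by apply: (@mulgI _ (f 1%g)); rewrite -fM // !mulg1.
pose base := [set x : G * D | N x.1 /\ x.2 = f x.1].
have basehom : partial_hom base base.
  split.
  - by move=> [x _] [y _] [/= Nx ->] [/= Ny ->]; split; [apply: NM | rewrite /= fM].
  - move=> [x _] [/= Nx ->]; split; first exact: NV.
    by apply: (@mulgI _ (f x)); rewrite -fM /= ?mulgV //; apply: NV.
  - by move=> d [/= _ ->].
  - by move=> x _ y.
have base1 : base (1, 1)%g by split.
have [R [PR maxR]] := Zorn_bigcup (@partial_hom_chain base).
(* A maximal relation cannot be empty, since [base] would properly contain it; being nonempty, it
   includes [base]. *)
have bR : base `<=` R.
  have [[x Rx]|R0] := pselect (R !=set0); first exact: (phom_base PR Rx).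
  case: (maxR base) => //; split; first by move=> x Rx; case: R0; exists x.
  by move=> /(_ _ base1) R1; apply: R0; exists (1, 1)%g.
have totR g : exists d, R (g, d).
  have [h [R' [PR' RR' R'g]]] := partial_hom_extend PR (bR _ base1) g.
  have [R'R|nR'R] := pselect (R' `<=` R); first by exists h; apply: R'R.
  by case: (maxR R').
have funR g d d' : R (g, d) -> R (g, d') -> d = d'.
  move=> Rd Rd'; have /= := phomM PR Rd (phomV PR Rd').
  by rewrite mulgV => /(phom1 PR) /divg1_eq.
have [F FP] := choice totR.
exists F; split=> [x y|x Nx].
  exact: (funR _ _ _ (FP _) (phomM PR (FP x) (FP y))).
by apply: (funR x) => //; apply: bR.
Qed.

End DivisibleExtension.

(** * Graded embeddings and isomorphisms of star-algebras *)

Definition graded_star_mono (C : numClosedFieldType) (A B : starAlgType C)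
    (G : Type) (gA : G -> set A) (gB : G -> set B) (f : A -> B) :=
  [/\ star_hom f, injective f & forall g x, gA g x <-> gB g (f x)].

Section LinearPredicate.
Variables (C : numClosedFieldType) (U V : lmodType C) (k : U -> V).
Hypothesis lk : linear k.

Lemma linear_predD : {morph k : x y / x + y}.
Proof. by move=> x y; rewrite -[x in LHS]scale1r lk scale1r. Qed.

Lemma linear_pred0 : k 0 = 0.
Proof. by apply: (addrI (k 0)); rewrite -linear_predD !addr0. Qed.

End LinearPredicate.

Section GradedMaps.
Context {C : numClosedFieldType} {G : Type}.

Lemma inj_surj_bij (X Y : Type) (f : X -> Y) :
  injective f -> (forall y, exists x, f x = y) -> bijective f.
Proof.
move=> fI /choice[g gK]; exists g => [x|y]; last exact: gK.
exact/fI/gK.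
Qed.

Lemma star_iso_inv (A B : starAlgType C) (f : A -> B) (g : B -> A) :
  star_hom f -> cancel f g -> cancel g f -> star_hom g.
Proof.
move=> hf fK gK; split.
- by move=> a x y; apply: (can_inj fK); rewrite (star_hom_linear hf) !gK.
- by move=> x y; apply: (can_inj fK); rewrite (star_homM hf) !gK.
- by apply: (can_inj fK); rewrite (star_hom1 hf) gK.
- by move=> x; apply: (can_inj fK); rewrite (star_homS hf) !gK.
Qed.

Lemma star_hom_comp (A B D : starAlgType C) (f : A -> B) (g : B -> D) :
  star_hom f -> star_hom g -> star_hom (g \o f).
Proof.
move=> hf hg; split=> [a x y|x y||x] /=.
- by rewrite (star_hom_linear hf) (star_hom_linear hg).
- by rewrite (star_homM hf) (star_homM hg).
- by rewrite (star_hom1 hf) (star_hom1 hg).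
- by rewrite (star_homS hf) (star_homS hg).
Qed.

Lemma graded_star_mono_iso (A B : starAlgType C) (gA : G -> set A)
    (gB : G -> set B) (f : A -> B) :
  graded_star_mono gA gB f -> (forall y, exists x, f x = y) ->
  graded_star_iso gA gB f.
Proof. by move=> [hf fI fg] fS; split=> //; split=> //; apply: inj_surj_bij. Qed.

Lemma graded_star_iso_mono (A B : starAlgType C) (gA : G -> set A)
    (gB : G -> set B) (f : A -> B) :
  graded_star_iso gA gB f -> graded_star_mono gA gB f.
Proof. by move=> [[hf fb] fg]; split=> //; apply: bij_inj. Qed.

Lemma graded_star_iso_inv (A B : starAlgType C) (gA : G -> set A)
    (gB : G -> set B) (f : A -> B) :
  graded_star_iso gA gB f -> exists g, graded_star_iso gB gA g.
Proof.
move=> [[hf [g fK gK]] fg]; exists g; split=> [|t y]; last by rewrite fg gK.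
by split; [apply: (star_iso_inv hf) | exists f].
Qed.

Lemma graded_star_mono_comp (A B D : starAlgType C) (gA : G -> set A)
    (gB : G -> set B) (gD : G -> set D) (f : A -> B) (h : B -> D) :
  graded_star_mono gA gB f -> graded_star_mono gB gD h ->
  graded_star_mono gA gD (h \o f).
Proof.
move=> [hf fI fg] [hh hI hg]; split; first exact: star_hom_comp.
  exact: inj_comp.
by move=> t x; rewrite fg hg.
Qed.

Lemma graded_star_iso_comp (A B D : starAlgType C) (gA : G -> set A)
    (gB : G -> set B) (gD : G -> set D) (f : A -> B) (h : B -> D) :
  graded_star_iso gA gB f -> graded_star_iso gB gD h ->
  graded_star_iso gA gD (h \o f).
Proof.
move=> [[hf fb] fg] [[hh hb] hg]; split; last by move=> t x; rewrite fg hg.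
by split; [apply: star_hom_comp | apply: bij_comp].
Qed.

Lemma star_range_subalg (A B : starAlgType C) (f : A -> B) : star_hom f ->
  subalg_closed (fun y => `[< range f y >] : bool).
Proof.
move=> hf; split; first by apply/asboolP; exists 1; rewrite ?(star_hom1 hf).
  move=> a _ _ /asboolP[x _ <-] /asboolP[y _ <-].
  by apply/asboolP; exists (a *: x + y); rewrite ?(star_hom_linear hf).
move=> _ _ /asboolP[x _ <-] /asboolP[y _ <-].
by apply/asboolP; exists (x * y); rewrite ?(star_homM hf).
Qed.

Lemma star_range_star (A B : starAlgType C) (f : A -> B) : star_hom f ->
  {in (fun y => `[< range f y >] : bool), forall y,
    star y \in (fun y => `[< range f y >] : bool)}.
Proof.
move=> hf _ /asboolP[x _ <-].
by apply/asboolP; exists (star x); rewrite ?(star_homS hf).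
Qed.

Definition star_range (A B : starAlgType C) (f : A -> B) (hf : star_hom f) :
    star_subalg B :=
  StarSubalg (star_range_subalg hf) (star_range_star hf).

Lemma graded_star_mono_range (A B : starAlgType C) (gA : G -> set A)
    (gB : G -> set B) (f : A -> B) : graded_star_mono gA gB f ->
  exists (S : star_subalg B) (phi : A -> S),
    graded_star_iso gA (sub_grading gB S) phi.
Proof.
move=> [hf fI fg]; exists (star_range hf).
have fP x : f x \in ss_pred (star_range hf) by apply/asboolP; exists x.
exists (fun x => exist _ (f x) (fP x)); apply: graded_star_mono_iso.
  split=> [|x y /(congr1 val) /fI //|//].
  split=> [a x y|x y||x]; apply: val_inj => /=.
  - exact: (star_hom_linear hf).
  - exact: (star_homM hf).
  - exact: (star_hom1 hf).
  - exact: (star_homS hf).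
move=> [y yP]; have /asboolP[x _ xy] := yP.
by exists x; apply: val_inj.
Qed.

End GradedMaps.

(** * Linear maps out of a crossed product *)

Section CrossedProductMaps.
Context {C : numClosedFieldType} {G : groupType} {B : starAlgType C}.
Variable tw : twisted_action G B.
Local Notation cp := (crossed_product tw).
Local Notation m := (fun s t => uval (coc tw s t)).

Lemma cp_gradingP t (f : cp) :
  cp_grading tw t f <-> f = cp_delta tw t (val f t).
Proof.
split=> [ft|-> s /negbTE /= ->//]; apply: cp_ext => s /=.
by case: eqP => [->//|/eqP /ft].
Qed.

Lemma cp_delta_linear t : linear (cp_delta tw t).
Proof.
move=> a x y; apply: cp_ext => s.
transitivity (a *: (if s == t then x else 0) + if s == t then y else 0) => //=.
by case: eqP => //; rewrite scaler0 addr0.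
Qed.

Section Sum.
Variables (W : lmodType C) (h : G -> B -> W).
Hypothesis h_lin : forall t, linear (h t).

(** The linear extension of a family of maps given degree by degree; linearity of [h t] keeps the
    sum finite. *)
Definition cp_sum (f : cp) : W := \sum_(t \in [set: G]) h t (val f t).

Lemma cp_sumE (D : {fset G}) (f : cp) :
  (forall t, t \notin D -> val f t = 0) ->
  cp_sum f = \sum_(t <- D) h t (val f t).
Proof. by move=> Df; apply: fsbigTE => t /Df ->; apply: linear_pred0. Qed.

Lemma cp_sum_linear : linear cp_sum.
Proof.
move=> a f g.
pose D := (fset_set [set s | val f s <> 0]%classic `|`
           fset_set [set s | val g s <> 0]%classic)%fset.
have D1 s : s \notin D -> val f s = 0.
  by rewrite in_fsetU negb_or => /andP[/cp_out].
have D2 s : s \notin D -> val g s = 0.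
  by rewrite in_fsetU negb_or => /andP[_ /cp_out].
have vE s : val (a *: f + g) s = a *: val f s + val g s by [].
rewrite (cp_sumE D1) (cp_sumE D2) (@cp_sumE D); last first.
  by move=> s sD; rewrite vE D1 // D2 // scaler0 addr0.
rewrite scaler_sumr -big_split /=; apply: eq_bigr => s _.
by rewrite -h_lin -vE.
Qed.

Lemma cp_sum_delta t b : cp_sum (cp_delta tw t b) = h t b.
Proof.
rewrite (@cp_sumE [fset t]%fset) /=; last first.
  by move=> s; rewrite in_fset1 => /negbTE ->.
by rewrite big_seq_fset1 eqxx.
Qed.

(** Reads off one coefficient of [f] from its image, with [q] killing all summands of degree other
    than [t]. *)
Lemma cp_sum_proj (Z : lmodType C) (q : W -> Z) (t : G) (k : B -> Z) :
  linear q -> linear k ->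
  (forall s b, q (h s b) = if s == t then k b else 0) ->
  forall f, q (cp_sum f) = k (val f t).
Proof.
move=> ql kl qh f.
elim/(@cp_ind _ _ _ tw): f => [|s b|f g IH IH'].
- by rewrite !(linear_pred0 cp_sum_linear) !linear_pred0.
- rewrite cp_sum_delta qh /= eq_sym.
  by case: eqP => // _; rewrite linear_pred0.
- rewrite (linear_predD cp_sum_linear) (linear_predD ql) IH IH'.
  by rewrite -(linear_predD kl).
Qed.

End Sum.

Lemma cp_hom_ext (W : lmodType C) (p q : cp -> W) : linear p -> linear q ->
  (forall t b, p (cp_delta tw t b) = q (cp_delta tw t b)) -> p =1 q.
Proof.
move=> lp lq pq; elim/(@cp_ind _ _ _ tw) => [|t b|f g IH IH'] //.
  by rewrite !linear_pred0.
by rewrite !linear_predD // IH IH'.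
Qed.

(** The product is biadditive and the star additive, so the identities need checking only on the
    functions [cp_delta]. *)
Lemma cp_sum_star_hom (W : starAlgType C) (h : G -> B -> W) :
  (forall t, linear (h t)) ->
  (forall s t b c, h s b * h t c = h (s * t)%g (b * act tw s c * m s t)) ->
  h 1%g 1 = 1 ->
  (forall t b, star (h t b) =
     h (t^-1)%g (star (m (t^-1)%g t) * act tw (t^-1)%g (star b))) ->
  star_hom (cp_sum h).
Proof.
move=> hl hM h1 hS.
have sl := cp_sum_linear hl.
have s0 : cp_sum h 0 = 0 := linear_pred0 sl.
have sD := linear_predD sl.
split=> //.
- move=> f g; elim/(@cp_ind _ _ _ tw): f => [|s b|f f' IH IH'].
  + by rewrite mul0r s0 mul0r.
  2: by rewrite mulrDl !sD mulrDl IH IH'.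
  elim/(@cp_ind _ _ _ tw): g => [|t c|f f' IH IH'].
  + by rewrite mulr0 s0 mulr0.
  2: by rewrite mulrDr !sD mulrDr IH IH'.
  by rewrite [_ * _]cp_mul_delta !cp_sum_delta.
- by rewrite [1](_ : _ = cp_delta tw 1%g 1) // cp_sum_delta.
- move=> f; elim/(@cp_ind _ _ _ tw): f => [|s b|f f' IH IH'].
  + by rewrite star0 s0 star0.
  + by rewrite [star _]cp_star_delta !cp_sum_delta.
  + by rewrite starD !sD starD IH IH'.
Qed.

End CrossedProductMaps.

(** * The tensor product with the group algebra as an untwisted crossed product *)

Section TensorGroupAlgebra.
Context {C : numClosedFieldType} {G : groupType} {B P : starAlgType C}.
Context {tau : B -> group_alg C G -> P}.
Hypothesis Htau : is_star_tensor tau.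
Local Notation cpB := (crossed_product (trivial_action G B)).
Local Notation lam := (@group_alg_basis C G).

Let tau_lin : bilinear2 tau :=
  tensor_bilinear (star_tensor_tensor Htau).

(** Uniqueness in the universal property: [p] and [q] factor the same bilinear map. *)
Lemma tensor_hom_ext (Z : lmodType C) (p q : P -> Z) : linear p -> linear q ->
  (forall b f, p (tau b f) = q (tau b f)) -> p =1 q.
Proof.
move=> lp lq pq.
have bi : bilinear2 (fun b f => q (tau b f)).
  by split=> [b a f g|f a b c] /=; rewrite ?(tau_lin.1 b) ?(tau_lin.2 f) lq.
have [g [_ _ gU]] := tensor_universal (star_tensor_tensor Htau) bi.
by move=> x; rewrite (gU p) // (gU q).
Qed.

Lemma tensor11 : tau 1 1 = 1.
Proof.
rewrite -[LHS]mulr1 -[RHS]/(idfun (1 : P)).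
apply: (@tensor_hom_ext _ (fun x => tau 1 1 * x) idfun) => //.
  by move=> a x y; rewrite mulrDr scalerAr.
by move=> b f; rewrite (star_tensorM Htau) !mul1r.
Qed.

Lemma group_alg_basisM s t : lam s * lam t = lam (s * t)%g.
Proof. by rewrite [LHS]cp_mul_delta /= !mulr1. Qed.

Lemma group_alg_basisS t : star (lam t) = lam (t^-1)%g.
Proof. by rewrite [LHS]cp_star_delta /= !star1 mulr1. Qed.

Lemma group_alg_deltaE t (c : C) : cp_delta (trivial_action G C^o) t c = c *: lam t.
Proof.
have dl := cp_delta_linear (trivial_action G C^o) t.
rewrite /group_alg_basis -[RHS]addr0 -(linear_pred0 dl).
by rewrite -dl addr0 [_ *: _]mulr1.
Qed.

Definition tensor_of_cp : cpB -> P := cp_sum (fun t b => tau b (lam t)).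

Lemma tensor_of_cp_hom : star_hom tensor_of_cp.
Proof.
apply: cp_sum_star_hom => [t|s t b c||t b].
- exact: tau_lin.2.
- by rewrite (star_tensorM Htau) group_alg_basisM /= mulr1.
- exact: tensor11.
- by rewrite (star_tensorS Htau) group_alg_basisS /= star1 mul1r.
Qed.

Fact scaled_finsupp (b : B) (f : group_alg C G) :
  (fun t => (val f t : C) *: b) \in Defs.finsupp.
Proof.
apply/Defs.finsuppP; have /Defs.finsuppP := valP f.
apply: sub_finite_set => t /= + ft.
by rewrite ft scale0r.
Qed.

(** The coordinates of the elementary tensor of [b] and [f]; the linear map induced on [P] will be
    the inverse of [tensor_of_cp]. *)
Definition cp_scaled (b : B) (f : group_alg C G) : cpB :=
  exist (fun h => h \in Defs.finsupp) _ (scaled_finsupp b f).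

Lemma cp_scaled_bilinear : bilinear2 cp_scaled.
Proof.
split=> [b a f g|f a b c]; apply: cp_ext => t.
- transitivity ((a * (val f t : C) + (val g t : C)) *: b) => //.
  by rewrite scalerDl -scalerA.
- transitivity ((val f t : C) *: (a *: b + c)) => //.
  by rewrite scalerDr !scalerA mulrC -scalerA.
Qed.

Lemma tensor_of_cp_scaled b f : tensor_of_cp (cp_scaled b f) = tau b f.
Proof.
have sl := cp_sum_linear (tw := trivial_action G B) (fun t => tau_lin.2 (lam t)).
pose p f := tensor_of_cp (cp_scaled b f).
apply: (@cp_hom_ext _ _ _ (trivial_action G C^o) _ p) => {f}.
- by move=> a f g; rewrite /p (cp_scaled_bilinear.1 b) [LHS]sl.
- exact: tau_lin.1.
move=> t c; rewrite /p (_ : cp_scaled _ _ = cp_delta _ t ((c : C) *: b)).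
  rewrite [LHS]cp_sum_delta; last by move=> s; apply: tau_lin.2.
  rewrite [in RHS]group_alg_deltaE.
  have tb := tau_lin.1 b.
  rewrite -[in RHS](addr0 (_ *: _)) tb (linear_pred0 tb).
  have tl := tau_lin.2 (lam t).
  by rewrite -[in LHS](addr0 (_ *: b)) tl (linear_pred0 tl).
by apply: cp_ext => s /=; case: eqP; rewrite ?scale0r.
Qed.

Lemma tensor_of_cp_iso :
  graded_star_iso (cp_grading (trivial_action G B))
    (tensor_group_alg_grading tau) tensor_of_cp.
Proof.
have hl t : linear (fun b => tau b (lam t)) := tau_lin.2 (lam t).
have sl := cp_sum_linear (tw := trivial_action G B) hl.
have [g [gl gtau _]] :=
  tensor_universal (star_tensor_tensor Htau) cp_scaled_bilinear.
have gK : cancel g tensor_of_cp.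
  apply: tensor_hom_ext => //; last first.
    by move=> b f; rewrite /= gtau tensor_of_cp_scaled.
  by move=> a x y; rewrite gl [LHS]sl.
have sK : cancel tensor_of_cp g.
  apply: cp_hom_ext => //; first by move=> a x y; rewrite [tensor_of_cp _]sl gl.
  move=> t b; rewrite [tensor_of_cp _]cp_sum_delta // gtau.
  by apply: cp_ext => s /=; case: eqP; rewrite ?scale0r ?scale1r.
split; first by split; [apply: tensor_of_cp_hom | exists g].
move=> t f; split=> [/cp_gradingP ->|[b _ tb]].
  by rewrite [tensor_of_cp _]cp_sum_delta //; exists (val f t).
apply/cp_gradingP; have -> : f = cp_delta _ t b.
  by apply: (can_inj sK); rewrite -tb [RHS]cp_sum_delta.
by rewrite /= eqxx.
Qed.

End TensorGroupAlgebra.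

(** * Absorbing a cocycle that becomes a coboundary *)

Section Untwisting.
Context {C : numClosedFieldType} {G : groupType} {B D : starAlgType C}.
Variables (tw : twisted_action G B) (iota : B -> D) (c : G -> unitary D).
Hypotheses (commD : forall a b : D, a * b = b * a) (hiota : star_hom iota)
  (iotaI : injective iota) (act_triv : forall s b, act tw s b = b)
  (c1 : c 1%g = 1%g)
  (c_coboundary : forall s t, iota (uval (coc tw s t)) * uval (c (s * t)%g) =
     uval (c s) * uval (c t)).
Local Notation cpD := (crossed_product (trivial_action G D)).

(** Rescaling the coefficient of degree [t] by [c t] absorbs the cocycle, whose image under [iota]
    is the defect of multiplicativity of [c]. *)
Definition untwist : crossed_product tw -> cpD :=
  cp_sum (fun t b => cp_delta (trivial_action G D) t (iota b * uval (c t))).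

Let hl t : linear (fun b =>
  cp_delta (trivial_action G D) t (iota b * uval (c t))).
Proof.
move=> a x y; rewrite (star_hom_linear hiota) mulrDl -scalerAl.
exact: cp_delta_linear.
Qed.

Lemma untwistE f t : val (untwist f) t = iota (val f t) * uval (c t).
Proof.
apply: (@cp_sum_proj _ _ _ tw _ _ hl D^o (fun x : cpD => val x t : D^o) t
  (fun b => iota b * uval (c t) : D^o)) => //.
  by move=> a x y; rewrite (star_hom_linear hiota) mulrDl -scalerAl.
by move=> s b /=; rewrite eq_sym; case: eqP => // ->.
Qed.

Lemma untwist_hom : star_hom untwist.
Proof.
apply: cp_sum_star_hom => // [s t x y||t b].
- rewrite [LHS]cp_mul_delta /= mulr1 act_triv !(star_homM hiota); congr cp_delta.
  rewrite -!mulrA c_coboundary; congr (_ * _).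
  by rewrite !mulrA (commD (uval _)).
- by rewrite c1 /= (star_hom1 hiota) mulr1.
rewrite [LHS]cp_star_delta /= star1 mul1r act_triv (star_homM hiota).
rewrite !(star_homS hiota) starM; congr cp_delta.
(* As [c 1 = 1], the cocycle at [t^-1, t] becomes [c (t^-1) * c t], and its star cancels the factor
   [c (t^-1)]. *)
have := c_coboundary (t^-1)%g t; rewrite mulVg c1 /= mulr1 => ->.
rewrite starM -!mulrA (commD _ (uval (c (t^-1)%g))).
by rewrite (mulrA (star (uval (c (t^-1)%g)))) mulVu mul1r.
Qed.

(** Multiplication by the unitary [c t] and [iota] are injective, so each coefficient is recovered
    from its image. *)
Lemma untwist_mono :
  graded_star_mono (cp_grading tw) (cp_grading (trivial_action G D)) untwist.
Proof.
have c_reg t : injective (fun x => x * uval (c t)).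
  move=> x y /(congr1 (fun z => z * star (uval (c t)))).
  by rewrite -!mulrA muluV !mulr1.
have iota0 := star_hom0 hiota.
split; first exact: untwist_hom.
  move=> f g fg; apply: cp_ext => t; apply: iotaI; apply: (c_reg t).
  by rewrite -!untwistE fg.
move=> t f; split=> ft s st; first by rewrite untwistE ft // iota0 mul0r.
by apply: iotaI; apply: (c_reg s); rewrite -untwistE ft // iota0 mul0r.
Qed.

Lemma untwist_iso : (forall d, exists b, iota b = d) ->
  graded_star_iso (cp_grading tw) (cp_grading (trivial_action G D)) untwist.
Proof.
move=> iotaS; apply: graded_star_mono_iso; first exact: untwist_mono.
elim/(@cp_ind _ _ _ (trivial_action G D)) => [|t d|_ _ [f <-] [g <-]].
- by exists 0; apply: (star_hom0 untwist_hom).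
- have [b bd] := iotaS (d * star (uval (c t))).
  exists (cp_delta _ t b); rewrite [LHS]cp_sum_delta // bd.
  by rewrite -mulrA mulVu mulr1.
- by exists (f + g); rewrite (star_homD untwist_hom).
Qed.

End Untwisting.

(** * The group of unitary families and a section of its quotient *)

Section UnitaryFamilyGroup.
Context {C : numClosedFieldType} {I : choiceType}.
Variable A : I -> starAlgType C.
Local Notation ufam := (ufam A).

Definition ufam_one : ufam := fun=> 1%g.
Definition ufam_mul (u v : ufam) : ufam := fun i => (u i * v i)%g.
Definition ufam_inv (u : ufam) : ufam := fun i => ((u i)^-1)%g.

Lemma ufam_mulA : associative ufam_mul.
Proof. by move=> u v w; apply/functional_extensionality_dep => i; apply: mulgA. Qed.
Lemma ufam_mul1g : left_id ufam_one ufam_mul.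
Proof. by move=> u; apply/functional_extensionality_dep => i; apply: mul1g. Qed.
Lemma ufam_mulg1 : right_id ufam_one ufam_mul.
Proof. by move=> u; apply/functional_extensionality_dep => i; apply: mulg1. Qed.
Lemma ufam_mulVg : left_inverse ufam_one ufam_inv ufam_mul.
Proof. by move=> u; apply/functional_extensionality_dep => i; apply: mulVg. Qed.
Lemma ufam_mulgV : right_inverse ufam_one ufam_inv ufam_mul.
Proof. by move=> u; apply/functional_extensionality_dep => i; apply: mulgV. Qed.

HB.instance Definition _ := isGroup.Build ufam
  ufam_mulA ufam_mul1g ufam_mulg1 ufam_mulVg ufam_mulgV.

Lemma ut_class1 : ut_class (1%g : ufam) = 1%g.
Proof. by []. Qed.
Lemma ut_classM (u v : ufam) : ut_class (u * v)%g = (ut_class u * ut_class v)%g.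
Proof. by rewrite [RHS]ut_mul_class. Qed.
Lemma ut_classV (u : ufam) : ut_class (u^-1)%g = ((ut_class u)^-1)%g.
Proof. by rewrite [RHS]ut_inv_class. Qed.

(** The value at the identity class is fixed to be the constant family 1, which normalizes the
    resulting cocycle. *)
Definition ut_section (w : Omega_ut A) : ufam :=
  if w == 1%g then 1%g else ut_repr w.

Lemma ut_section1 : ut_section 1%g = 1%g.
Proof. by rewrite /ut_section eqxx. Qed.

Lemma ut_sectionK w : ut_class (ut_section w) = w.
Proof. by rewrite /ut_section; case: eqP => [->|_]; [|apply: ut_reprK]. Qed.

(** The defect of multiplicativity of the section; it lies in the kernel of [ut_class], so it is 1
    almost everywhere. *)
Definition ut_cocycle (s t : Omega_ut A) : ufam :=
  (ut_section s * ut_section t * (ut_section (s * t))^-1)%g.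

Lemma ut_class_cocycle s t : ut_class (ut_cocycle s t) = 1%g.
Proof. by rewrite !ut_classM ut_classV !ut_sectionK mulgV. Qed.

End UnitaryFamilyGroup.

(** The default 1 makes the map total; a star-homomorphism carries unitaries to unitaries and never
    reaches it. *)
Definition unitary_map (C : numClosedFieldType) (A B : starAlgType C)
  (f : A -> B) (u : unitary A) : unitary B := insubd (1%g : unitary B) (f (uval u)).

Lemma unitary_mapE (C : numClosedFieldType) (A B : starAlgType C)
  (f : A -> B) (u : unitary A) : star_hom f ->
  uval (unitary_map f u) = f (uval u).
Proof.
move=> hf; apply: insubdK; rewrite unfold_in -!(star_homS hf) -!(star_homM hf).
by rewrite mulVu muluV (star_hom1 hf) eqxx.
Qed.

(** * Projections onto the components and unitary elementary tensors *)

Section UnitaryTensors.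
Context {C : numClosedFieldType} {I : choiceType} {A : I -> starAlgType C}.
Context {T : starAlgType C} {Theta : (forall i, A i) -> T}.
Hypothesis HT : is_star_itensor Theta.

Lemma itensor_hom_ext (Z : lmodType C) (p q : T -> Z) : linear p -> linear q ->
  (forall x, p (Theta x) = q (Theta x)) -> p =1 q.
Proof.
move=> lp lq pq.
have ml : multilinear (X := fun i => A i) (fun x => q (Theta x)).
  move=> x i a v w /=.
  by rewrite (itensor_multilinear (star_itensor_tensor HT)) lq.
have [g [_ _ gU]] := itensor_universal (star_itensor_tensor HT) ml.
by move=> x; rewrite (gU p) // (gU q).
Qed.

Lemma itensor_comm : (forall i (a b : A i), a * b = b * a) ->
  forall x y : T, x * y = y * x.
Proof.
move=> cA x y; move: y; apply: itensor_hom_ext.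
- by move=> a y z; rewrite mulrDr scalerAr.
- by move=> a y z; rewrite mulrDl scalerAl.
move=> b; move: x; apply: (@itensor_hom_ext _ ( *%R^~ (Theta b)) ( *%R (Theta b))).
- by move=> a y z; rewrite /= mulrDl scalerAl.
- by move=> a y z; rewrite mulrDr scalerAr.
move=> a; rewrite !(star_itensorM HT); congr Theta.
by apply/functional_extensionality_dep => i; apply: cA.
Qed.

(** Replacing [Theta] by zero off the families almost everywhere equal to a representative of [w]
    keeps it multilinear, since altering one coordinate does not affect that relation. The induced
    map shows that the sum of the components is direct. *)
Lemma tensor_projection (w : Omega_ut A) :
  exists2 p : T -> T, linear p &
    forall v y, tensor_comp Theta v y -> p y = if v == w then y else 0.
Proof.
pose R := fun i => uval (ut_repr w i).
pose f x := if `[< cofin_eq x R >] then Theta x else 0.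
have ml : multilinear (X := fun i => A i) f.
  move=> x i a y z; rewrite /f.
  have simE v v' : cofin_eq (dfwith x i v) R -> cofin_eq (dfwith x i v') R.
    apply: cofin_eq_trans; apply: (@sub_finite_set _ _ [set i]).
      move=> j /= n; have [//|ij] := eqVneq i j; case: n.
      by rewrite !dfwithout.
    exact: finite_set1.
  have bE v v' : `[< cofin_eq (dfwith x i v) R >] =
      `[< cofin_eq (dfwith x i v') R >].
    by apply/asboolP/asboolP; apply: simE.
  rewrite (bE (a *: y + z) z) (bE y z); case: asboolP => _.
    exact: (itensor_multilinear (star_itensor_tensor HT)).
  by rewrite scaler0 addr0.
have [p [pl pT _]] := itensor_universal (star_itensor_tensor HT) ml.
exists p => // v y; move: y; apply: lspan_ind => [|a y z [x xv <-] IH].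
  by rewrite linear_pred0 //; case: ifP.
rewrite pl pT IH /f; have [e|/eqP ne] := eqVneq v w.
  by case: asboolP => // -[]; rewrite /R -e.
case: asboolP => [xw|_]; last by rewrite scaler0 addr0.
case: ne; rewrite -(ut_reprK v) -(ut_reprK w); apply/ut_classP.
have := cofin_eq_trans (cofin_eq_sym xv) xw.
by apply: sub_finite_set => i /= n e; apply: n; apply: val_inj.
Qed.

Definition utensor (u : ufam A) : T := Theta (fun i => uval (u i)).

Lemma utensorM u v : utensor (u * v)%g = utensor u * utensor v.
Proof. by rewrite /utensor (star_itensorM HT). Qed.
Lemma utensorV u : utensor (u^-1)%g = star (utensor u).
Proof. by rewrite /utensor (star_itensorS HT). Qed.
Lemma utensor1 : utensor 1%g = 1.
Proof. exact: (itensor1 HT). Qed.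
Lemma utensorVK u : star (utensor u) * utensor u = 1.
Proof. by rewrite -utensorV -utensorM mulVg utensor1. Qed.
Lemma utensorKV u : utensor u * star (utensor u) = 1.
Proof. by rewrite -utensorV -utensorM mulgV utensor1. Qed.

Lemma tensor_comp_utensor u : tensor_comp Theta (ut_class u) (utensor u).
Proof.
rewrite tensor_comp_class; apply: lspan_sub.
by eexists; [apply: cofin_eq_refl|].
Qed.

Lemma tensor_compM v w x y : tensor_comp Theta v x -> tensor_comp Theta w y ->
  tensor_comp Theta (v * w)%g (x * y).
Proof. by move=> xv yw; rewrite tensor_comp_class; apply: (tensor_atM HT xv yw). Qed.

Lemma tensor_compS w x : tensor_comp Theta w x ->
  tensor_comp Theta (w^-1)%g (star x).
Proof. by move=> xw; rewrite tensor_comp_class; apply: (tensor_atS HT xw). Qed.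

Lemma tensor_eP x : x \in ss_pred (tensor_e HT) <-> tensor_comp Theta 1%g x.
Proof. by rewrite tensor_comp_class; split=> [/asboolP|?]//; apply/asboolP. Qed.

Lemma tensor_utP w x : tensor_comp Theta w x -> x \in ss_pred (tensor_ut HT).
Proof. by move=> xw; apply/asboolP/lspan_sub; exists w. Qed.

(** If [u] is 1 almost everywhere, its tensor is a unitary of the unit component and neither
    default, 0 or 1, is taken. *)
Definition utensor_e (u : ufam A) : unitary (tensor_e HT) :=
  insubd (1%g : unitary (tensor_e HT)) (insubd (0 : tensor_e HT) (utensor u)).

Lemma utensor_eE u : ut_class u = 1%g -> val (uval (utensor_e u)) = utensor u.
Proof.
move=> u1; have e : val (insubd (0 : tensor_e HT) (utensor u)) = utensor u.
  by apply: insubdK; apply/tensor_eP; rewrite -u1; apply: tensor_comp_utensor.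
rewrite insubdK // unfold_in; apply/andP; split; apply/eqP/val_inj.
  by rewrite /= e utensorVK.
by rewrite /= e utensorKV.
Qed.

(** * The twisted action and the isomorphism from its crossed product *)

Local Notation W w := (utensor (ut_section w)).

Lemma tensor_comp_section w : tensor_comp Theta w (W w).
Proof. by have := tensor_comp_utensor (ut_section w); rewrite ut_sectionK. Qed.

Fact tensor_act_subproof (s : Omega_ut A) (b : tensor_e HT) :
  W s * val b * star (W s) \in ss_pred (tensor_e HT).
Proof.
(* Degrees multiply, and [s * 1 * s^-1 = 1]. *)
apply/tensor_eP; rewrite -(mulgV s) -[X in (X / _)%g]mulg1.
apply: tensor_compM; last exact/tensor_compS/tensor_comp_section.
apply: tensor_compM; first exact: tensor_comp_section.
by apply/tensor_eP; apply: valP.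
Qed.
Definition tensor_act s b : tensor_e HT :=
  exist (fun x => x \in ss_pred (tensor_e HT)) _ (tensor_act_subproof s b).

Fact tensor_unact_subproof (s : Omega_ut A) (b : tensor_e HT) :
  star (W s) * val b * W s \in ss_pred (tensor_e HT).
Proof.
apply/tensor_eP; rewrite -(mulVg s) -[X in (X * _)%g]mulg1.
apply: tensor_compM; last exact/tensor_comp_section.
apply: tensor_compM; first exact/tensor_compS/tensor_comp_section.
by apply/tensor_eP; apply: valP.
Qed.
Definition tensor_unact s b : tensor_e HT :=
  exist (fun x => x \in ss_pred (tensor_e HT)) _ (tensor_unact_subproof s b).

Definition tensor_coc (s t : Omega_ut A) : unitary (tensor_e HT) :=
  utensor_e (ut_cocycle s t).

Lemma tensor_cocE s t :
  val (uval (tensor_coc s t)) = W s * W t * star (W (s * t)%g).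
Proof. by rewrite utensor_eE ?ut_class_cocycle // !utensorM utensorV. Qed.

Lemma tensor_act_aut s : star_iso (tensor_act s).
Proof.
have WV := utensorVK (ut_section s); have VW := utensorKV (ut_section s).
split; last first.
  exists (tensor_unact s) => b; apply: val_inj => /=.
    by rewrite !mulrA WV mul1r -mulrA WV mulr1.
  by rewrite !mulrA VW mul1r -mulrA VW mulr1.
split=> [a x y|x y||x]; apply: val_inj => /=.
- by rewrite mulrDr mulrDl -scalerAr -scalerAl.
- by rewrite !mulrA -(mulrA (_ * _) (star _) (W s)) WV mulr1.
- by rewrite mulr1.
- by rewrite !starM starK mulrA.
Qed.

Lemma utensor_section1 : W 1%g = 1.
Proof. by rewrite ut_section1 utensor1. Qed.

Lemma tensor_act1 b : tensor_act 1%g b = b.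
Proof. by apply: val_inj; rewrite /= utensor_section1 star1 mul1r mulr1. Qed.

Lemma tensor_coc1l s : tensor_coc 1%g s = 1%g.
Proof.
apply/val_inj/val_inj; rewrite [LHS]tensor_cocE utensor_section1 mul1r mul1g.
exact: utensorKV.
Qed.

Lemma tensor_coc1r s : tensor_coc s 1%g = 1%g.
Proof.
apply/val_inj/val_inj; rewrite [LHS]tensor_cocE utensor_section1 mulr1 mulg1.
exact: utensorKV.
Qed.

(** Both sides are conjugation by [W s * W t]: the factors [W (s * t)] of the cocycle and of the
    action cancel. *)
Lemma tensor_act_act s t b : tensor_act s (tensor_act t b) =
  uval (tensor_coc s t) * tensor_act (s * t)%g b * star (uval (tensor_coc s t)).
Proof.
have WV w := utensorVK (ut_section w).
apply: val_inj => /=; rewrite tensor_cocE !starM starK !mulrA.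
by rewrite -(mulrA _ (star (W (s * t)%g)) (W (s * t)%g)) WV mulr1
  -(mulrA _ (star (W (s * t)%g)) (W (s * t)%g)) WV mulr1.
Qed.

Lemma tensor_cocycleP r s t :
  tensor_act r (uval (tensor_coc s t)) * uval (tensor_coc r (s * t)%g) =
  uval (tensor_coc r s) * uval (tensor_coc (r * s)%g t).
Proof.
have WV w := utensorVK (ut_section w).
apply: val_inj => /=; rewrite !tensor_cocE !mulrA.
rewrite -(mulrA _ (star (W r)) (W r)) WV mulr1.
rewrite -(mulrA _ (star (W (s * t)%g)) (W (s * t)%g)) WV mulr1.
by rewrite -(mulrA _ (star (W (r * s)%g)) (W (r * s)%g)) WV mulr1 mulgA.
Qed.

Definition tensor_twisted : twisted_action (Omega_ut A) (tensor_e HT) :=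
  TwistedAction tensor_act_aut tensor_act1 tensor_coc1l tensor_coc1r
    tensor_act_act tensor_cocycleP.

Fact tensor_ut_mul_subproof (t : Omega_ut A) (b : tensor_e HT) :
  val b * W t \in ss_pred (tensor_ut HT).
Proof.
apply: (@tensor_utP (1 * t)%g); apply: tensor_compM.
  by apply/tensor_eP; apply: valP.
exact: tensor_comp_section.
Qed.
Definition tensor_ut_mul t b : tensor_ut HT :=
  exist (fun x => x \in ss_pred (tensor_ut HT)) _ (tensor_ut_mul_subproof t b).

Lemma tensor_ut_mul_linear t : linear (tensor_ut_mul t).
Proof. by move=> a x y; apply: val_inj; rewrite /= mulrDl -scalerAl. Qed.

Definition tensor_ut_of_cp : crossed_product tensor_twisted -> tensor_ut HT :=
  cp_sum tensor_ut_mul.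

(** Inserting [star (W s) * W s = 1] rewrites [b * W s * c * W t] as [b], times the conjugate of [c]
    by [W s], times the cocycle, times [W (s * t)]. *)
Lemma tensor_ut_of_cp_hom : star_hom tensor_ut_of_cp.
Proof.
have WV w := utensorVK (ut_section w).
apply: cp_sum_star_hom => [t|s t b c||t b].
- exact: tensor_ut_mul_linear.
- apply: val_inj => /=; rewrite tensor_cocE !mulrA.
  rewrite -(mulrA _ (star (W s)) (W s)) WV mulr1.
  by rewrite -(mulrA _ (star (W (s * t)%g)) (W (s * t)%g)) WV mulr1.
- by apply: val_inj; rewrite /= utensor_section1 mulr1.
- apply: val_inj => /=; rewrite tensor_cocE mulVg utensor_section1 star1 mulr1.
  rewrite !starM !mulrA -(mulrA _ (star _) (W _)) WV mulr1.
  by rewrite -(mulrA _ (star (W (t^-1)%g)) (W _)) WV mulr1.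
Qed.

(** The projections recover each [val f t * W t], which gives injectivity and reflection of the
    grading. *)
Lemma tensor_ut_of_cp_iso : graded_star_iso (cp_grading tensor_twisted)
  (tensor_ut_grading HT) tensor_ut_of_cp.
Proof.
have WV w := utensorVK (ut_section w).
have VW w := utensorKV (ut_section w).
have hom := tensor_ut_of_cp_hom.
have Wreg w : injective (fun b : tensor_e HT => val b * W w).
  move=> b c /(congr1 (fun z => z * star (W w))).
  by rewrite -!mulrA VW !mulr1 => /val_inj.
have deltaE t b : val (tensor_ut_of_cp (cp_delta _ t b)) = val b * W t.
  by rewrite [tensor_ut_of_cp _]cp_sum_delta //; apply: tensor_ut_mul_linear.
have eW t (b : tensor_e HT) : tensor_comp Theta t (val b * W t).
  rewrite -[t in tensor_comp _ t]mul1g; apply: tensor_compM.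
    by apply/tensor_eP; apply: valP.
  exact: tensor_comp_section.
have projE t : exists2 p : T -> T, (forall s y, tensor_comp Theta s y ->
    p y = if s == t then y else 0) &
    forall f, p (val (tensor_ut_of_cp f)) = val (val f t) * W t.
  have [p lp pE] := tensor_projection t; exists p => //.
  apply: (@cp_sum_proj _ _ _ tensor_twisted _ _ tensor_ut_mul_linear T
    (fun x : tensor_ut HT => p (val x)) t (fun b => val b * W t)).
  - by move=> a x y; rewrite /= lp.
  - by move=> a x y; rewrite /= mulrDl -scalerAl.
  - by move=> s b; rewrite (pE s _ (eW s b)); have [->|] := eqVneq s t.
apply: graded_star_mono_iso.
  split=> // [f g fg|t f].
    apply: cp_ext => t; apply: (Wreg t).
    by have [p _ pf] := projE t; rewrite -!pf fg.
  split=> [/cp_gradingP ->|ft].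
    by rewrite /tensor_ut_grading /sub_grading /= deltaE.
  move=> s st; apply: (Wreg s); have [p pE pf] := projE s.
  by rewrite -pf (pE t) // eq_sym (negbTE st) mul0r.
move=> [y yP]; have /asboolP yU := yP.
suff [f fy] : exists f, val (tensor_ut_of_cp f) = y.
  by exists f; apply: val_inj.
move: y {yP} yU; apply: lspan_ind => [|a u v [w _ uw] [g gv]].
  by exists 0; rewrite (star_hom0 hom).
(* Surjectivity: [u] has degree [w], so [u * star (W w)] has degree 1 and can serve as a
   coefficient. *)
have uP : u * star (W w) \in ss_pred (tensor_e HT).
  apply/tensor_eP; rewrite -(mulgV w); apply: tensor_compM => //.
  exact/tensor_compS/tensor_comp_section.
pose b : tensor_e HT := exist (fun x => x \in ss_pred (tensor_e HT)) _ uP.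
exists (a *: cp_delta _ w b + g); rewrite (star_hom_linear hom) /= deltaE gv /=.
by rewrite -mulrA WV mulr1.
Qed.

(** Following [utensor_e] by [iota] gives a homomorphism on the kernel of [ut_class]; its extension
    [chi] to all unitary families, restricted along the section, is [c]. *)
Lemma utensor_trivialization (B : starAlgType C) (iota : tensor_e HT -> B) :
  (forall i (a b : A i), a * b = b * a) ->
  (forall a b : B, a * b = b * a) -> star_hom iota -> divisible (unitary B) ->
  exists c : Omega_ut A -> unitary B, c 1%g = 1%g /\
    forall s t, iota (uval (tensor_coc s t)) * uval (c (s * t)%g) =
      uval (c s) * uval (c t).
Proof.
move=> cA cB hi divB.
have cU (D : starAlgType C) : (forall a b : D, a * b = b * a) ->
    forall u v : unitary D, (u * v = v * u)%g.
  by move=> cD u v; apply: val_inj; apply: cD.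
have cF (u v : ufam A) : (u * v = v * u)%g.
  by apply/functional_extensionality_dep => i; apply: cU.
have ueM u v : ut_class u = 1%g -> ut_class v = 1%g ->
    utensor_e (u * v)%g = (utensor_e u * utensor_e v)%g.
  move=> u1 v1; apply/val_inj/val_inj.
  by rewrite /= !utensor_eE ?utensorM // ut_classM u1 v1 mulg1.
have fM u v : ut_class u = 1%g -> ut_class v = 1%g ->
    unitary_map iota (utensor_e (u * v)%g) =
    (unitary_map iota (utensor_e u) * unitary_map iota (utensor_e v))%g.
  move=> u1 v1; apply: val_inj.
  by rewrite /= !unitary_mapE // ueM //= (star_homM hi).
have NM (u v : ufam A) : ut_class u = 1%g -> ut_class v = 1%g ->
    ut_class (u * v)%g = 1%g.
  by rewrite ut_classM => -> ->; rewrite mulg1.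
have NV (u : ufam A) : ut_class u = 1%g -> ut_class (u^-1)%g = 1%g.
  by rewrite ut_classV => ->; rewrite invg1.
have [chi [chiM chiE]] :=
  divisible_hom_extension cF (cU _ cB) divB (ut_class1 A) NM NV fM.
exists (chi \o @ut_section _ _ _); split=> [|s t] /=.
  by rewrite ut_section1; apply: (@mulgI _ (chi 1%g)); rewrite -chiM !mulg1.
(* The cocycle family lies in the kernel, where [chi] is prescribed by [iota]. *)
have <- : uval (chi (ut_cocycle s t)) = iota (uval (tensor_coc s t)).
  by rewrite chiE ?unitary_mapE //; apply: ut_class_cocycle.
by rewrite -[LHS]/(uval (_ * _)%g) -chiM mulgVK chiM.
Qed.

End UnitaryTensors.

(** * Composition of the graded maps *)

Theorem theorem3p2 (R : realType) (I : choiceType)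
    (infI : infinite_set [set: I])
    (A : I -> starAlgType R[i])
    (T : starAlgType R[i]) (Theta : (forall i, A i) -> T)
    (HT : is_star_itensor Theta) :
  (exists (tw : twisted_action (Omega_ut A) (tensor_e HT))
          (phi : tensor_ut HT -> crossed_product tw),
      graded_star_iso (tensor_ut_grading HT)
        (cp_grading tw) phi)
  /\
  ((forall i (a b : A i), a * b = b * a) ->
     (forall (B : starAlgType R[i]) (iota : tensor_e HT -> B),
        (forall a b : B, a * b = b * a) ->
        star_hom iota -> injective iota ->
        divisible (unitary B) ->
        forall (P : starAlgType R[i])
               (tau : B -> group_alg R[i] (Omega_ut A) -> P),
          is_star_tensor tau ->
          exists (S : star_subalg P) (phi : tensor_ut HT -> S),
            graded_star_iso
              (tensor_ut_grading HT)
              (sub_grading (tensor_group_alg_grading tau) S) phi)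
     /\
     (divisible (unitary (tensor_e HT)) ->
        forall (P : starAlgType R[i])
               (tau : tensor_e HT -> group_alg R[i] (Omega_ut A) -> P),
          is_star_tensor tau ->
          exists phi : tensor_ut HT -> P,
            graded_star_iso
              (tensor_ut_grading HT)
              (tensor_group_alg_grading tau) phi)).
Proof.
have psi_iso := tensor_ut_of_cp_iso HT.
have [phi phi_iso] := graded_star_iso_inv psi_iso.
split; first by exists (tensor_twisted HT), phi.
move=> cA.
have cT := itensor_comm HT cA.
have act_triv s b : act (tensor_twisted HT) s b = b.
  apply: val_inj; rewrite /= (cT _ (val b)) -mulrA.
  by rewrite (utensorKV HT) mulr1.
split.
- move=> B iota cB hiota iotaI divB P tau Htau.
  have [c [c1 cE]] := utensor_trivialization cA cB hiota divB.
  (* The embedding passes through the twisted crossed product and the untwisted one over [B]; its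
     range is the subalgebra sought. *)
  apply: graded_star_mono_range.
  apply: (graded_star_mono_comp (graded_star_iso_mono phi_iso)).
  apply: (graded_star_mono_comp (untwist_mono cB hiota iotaI act_triv c1 cE)).
  exact/graded_star_iso_mono/(tensor_of_cp_iso Htau).
- move=> divE P tau Htau.
  have cE (a b : tensor_e HT) : a * b = b * a by apply: val_inj; apply: cT.
  (* Here [B] is the unit component and [iota] the identity, so untwisting is also onto. *)
  have hid : star_hom (fun b : tensor_e HT => b) by split.
  have [c [c1 cc]] := utensor_trivialization cA cE hid divE.
  eexists; apply: (graded_star_iso_comp phi_iso).
  apply: (graded_star_iso_comp _ (tensor_of_cp_iso Htau)).
  apply: (untwist_iso cE hid _ act_triv c1 cc) => // d.
  by exists d.
Qed.
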